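(* Let $P=\langle a,b\mid u=v\rangle^+$ and $G=\langle a,b\mid u=v\rangle$ be as in the context ($P$ right LCM and left reversible, with the standing assumptions on the presentation), let $w\in P$ satisfy $w=ax=xx'=by=yy'$ for some $x,y,x',y'\in P$, and let $Y:=\{\chi\in\Omega_\infty:\chi(wP)=0\}$. I. Assume that one may take $w=u=v$ (i.e. the element of $P$ represented by $u$ and $v$ can be written as $ax=xx'=by=yy'$ for some $x,y,x',y'\in P$, and $w$ is this element). Let $L:=\max(\ell^*(u),\ell^*(v))-1$. Define a graph $\mathcal E$: $\mathcal E^0$ is the (finite) collection of all finite subwords of length $L$ of $u,v$-free infinite words; $\mathcal E^1:=\{(y,x): y,x\in\mathcal E^0;\ \exists\,\sigma,\tau\in\{a,b\}:\ y\tau\equiv\sigma x\text{ is }u,v\text{-free}\}$; $r(y,x)=y$, $s(y,x)=x$. Define $\boldsymbol\sigma:\mathcal E^1\to\{a,b\}$ by letting $\boldsymbol\sigma(y,x)$ be the first letter of $y$. Then $(\mathcal E,\boldsymbol\sigma)$ is a graph model for $G\curvearrowright Y$. II. (Here it is not assumed that $w=u=v$.) Suppose the following hold: II.1. Let $\mathcal X:=\{z\in\{a,b\}^*: z\ v\text{-free},\ z\in wP\}$. There exists a finite subset $\mathcal W\subseteq\mathcal X$ such that for all $z\in\mathcal X$ there is $x\in\mathcal W$ such that $x$ is a subword of $z$. II.2. $u$ is not a subword of $v$, no non-empty prefix of $u$ is a suffix of $v$, no non-empty suffix of $u$ is a prefix of $v$, and $v$ is not a subword of $u$. II.3. There exists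 $k\ge0$ such that for all words $z\equiv ar$ and $\bar z\equiv bs$ in $\{a,b\}^*$ which do not contain $v$ as a subword and with $\ell^*(r),\ell^*(s)\ge k$, we have $zP\cap\bar zP\subseteq wP$. Let $L:=\max\{\ell^*(x): x\in\{v\}\cup\mathcal W\}-1$. Define a graph $\mathcal E$: $\mathcal E^0$ is the (finite) collection of all finite subwords of length $L$ of $v,\mathcal W$-free infinite words; $\mathcal E^1:=\{(y,x): y,x\in\mathcal E^0;\ \exists\,\sigma,\tau\in\{a,b\}:\ y\tau\equiv\sigma x\text{ is }v,\mathcal W\text{-free}\}$; $r(y,x)=y$, $s(y,x)=x$. Define $\boldsymbol\sigma:\mathcal E^1\to\{a,b\}$ by letting $\boldsymbol\sigma(y,x)$ be the first letter of $y$. Then $(\mathcal E,\boldsymbol\sigma)$ is a graph model for $G\curvearrowright Y$.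
   Context: Monoid. $\Sigma=\{a,b\}$, $\Sigma^*$ is the set of finite words, $\Sigma^\infty$ the set of (one-sided) infinite words, $\equiv$ is equality of words, $=$ is equality in $P$, $\ell^*$ is word length, ''subword'' means block of consecutive letters. $P=\langle a,b\mid u=v\rangle^+$ is the monoid, $G=\langle a,b\mid u=v\rangle$ the group, given by the relation $u=v$. Standing assumptions: $u,v$ are non-empty distinct words; neither generator equals in $P$ a word in the other generator; the first letters of $u$ and $v$ differ and the last letters of $u$ and $v$ differ. Then $P\to G$ is injective and $P\subseteq G$. $P$ is right LCM (for $p,q\in P$, $pP\cap qP$ is empty or of the form $rP$) and left reversible ($pP\cap qP\neq\emptyset$ for all $p,q\in P$). A finite or infinite word is $u,v$-free if it contains neither $u$ nor $v$ as a finite subword, $v$-free if it does not contain $v$ as a finite subword, and $v,\mathcal W$-free if it is $v$-free and contains no $x\in\mathcal W$ as a finite subword. Character space. $\mathcal J=\{pP: p\in P\}\cup\{\emptyset\}$; $\Omega$ is the set of surjective multiplicative maps $\chi:\mathcal J\to\{0,1\}$ with $\chi(\emptyset)=0$ (multiplicative: $\chi(S\cap T)=\chi(S)\chi(T)$), with pointwise convergence. $P\subseteq\Omega$ via $p\mapsto\chi_{pP}$, $\chi_{pP}(xP)=1$ iff $pP\subseteq xP$; $\Omega_\infty=\Omega\setminus P$. For a finite word $z$ representing $p\in P$ put $\chi_z=\chi_{pP}$; for $z\in\Sigma^\infty$, $\chi_z(xP)=1$ iff some finite prefix of $z$ lies in $xP$. Partial action $G\curvearrowright\Omega$: $U_{g^{-1}}$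 is the set of $\chi$ with $\chi(qP)=1$ for some $q\in P$ such that $g=pq^{-1}$ with $p\in P$; then $(g.\chi)(xP)=\chi(qyP)$ if $xP\cap pP=pyP$, and $(g.\chi)(xP)=0$ if $xP\cap pP=\emptyset$. For a closed subset $Z\subseteq\Omega$, $G\ltimes Z$ is the topological groupoid $\{(g,\chi)\in G\times Z:\chi\in U_{g^{-1}},\ g.\chi\in Z\}$ with source $\chi$ and range $g.\chi$. Graph models. For a graph $\mathcal E$ (vertices $\mathcal E^0$, edges $\mathcal E^1$, range $r$, source $s$), paths are words $\mu_1\mu_2\cdots$ of edges with $s(\mu_i)=r(\mu_{i+1})$; $\mathcal E^*$, $\mathcal E^\infty$ are the sets of finite (including vertices, as paths of length $0$) and infinite paths, $l(\cdot)$ is path length. $\partial\mathcal E$ consists of all infinite paths and those finite paths $\mu$ with $|r^{-1}(s(\mu))|\in\{0,\infty\}$; its topology has as basis the sets $Z(\mu)\setminus\bigcup_{\nu\in F}Z(\mu\nu)$, where $\mu\in\mathcal E^*$, $F$ is a finite set of edges with range $s(\mu)$, and $Z(\mu)$ is the set of paths in $\partial\mathcal E$ starting with $\mu$. $\mathcal G_{\mathcal E}$ is the groupoid of triples $(\lambda\zeta,\,l(\lambda)-l(\mu),\,\mu\zeta)$ with $\lambda,\mu\in\mathcal E^*$, $\zeta\in\partial\mathcal E$, $s(\lambda)=s(\mu)=r(\zeta)$, with the usual étale topology (basis: fix $\lambda,\mu$ and let $\zeta$ vary in an open set). Given $\boldsymbol\sigma:\mathcal E^1\to\Sigma$, extend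 it letterwise to $\mathcal E^*\to\Sigma^*$ and $\mathcal E^\infty\to\Sigma^\infty$, and let $\varphi:\partial\mathcal E\to\Omega$, $\varphi(\mu)=\chi_{\boldsymbol\sigma(\mu)}$. $(\mathcal E,\boldsymbol\sigma)$ is a graph model for $G\curvearrowright Z$ if $\Phi:\mathcal G_{\mathcal E}\to G\ltimes Z$, $(\lambda\zeta,l(\lambda)-l(\mu),\mu\zeta)\mapsto(\boldsymbol\sigma(\lambda)\boldsymbol\sigma(\mu)^{-1},\varphi(\mu\zeta))$, is an isomorphism of topological groupoids. *)

(* Defs.v *)
From HB Require Import structures.
From mathcomp Require Import all_boot all_order all_algebra.
From mathcomp Require Import all_classical all_reals topology.

Set Implicit Arguments.
Unset Strict Implicit.
Unset Printing Implicit Defensive.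

Local Open Scope classical_set_scope.
Local Open Scope group_scope.
Local Open Scope quotient_scope.

Section PresentedMonoid.
Variables (A : choiceType) (R : seq A -> seq A -> Prop).

Inductive cong : seq A -> seq A -> Prop :=
| cong_refl s : cong s s
| cong_sym s t : cong s t -> cong t s
| cong_trans s t r : cong s t -> cong t r -> cong s r
| cong_rel p s t q : R s t -> cong (p ++ s ++ q) (p ++ t ++ q).

Lemma cong_cat2 p q s t : cong s t -> cong (p ++ s ++ q) (p ++ t ++ q).
Proof.
elim=> [r|r r' _ /cong_sym //|r r' r'' _ h _ h'|p' r r' q' Rrr'].
- exact: cong_refl.
- exact: cong_trans h h'.
- have := cong_rel (p ++ p') (q' ++ q) Rrr'; by rewrite -!catA.
Qed.

Lemma cong_cat s s' t t' : cong s s' -> cong t t' -> cong (s ++ t) (s' ++ t').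
Proof.
move=> hs ht; apply: (@cong_trans _ (s' ++ t)).
  exact: (@cong_cat2 [::] t).
by have := @cong_cat2 s' [::] _ _ ht; rewrite !cats0.
Qed.

Definition congb : rel (seq A) := fun s t => `[< cong s t >].

Lemma congb_refl : reflexive congb.
Proof. by move=> s; apply/asboolP/cong_refl. Qed.
Lemma congb_sym : symmetric congb.
Proof. by move=> s t; apply/asboolP/asboolP => /cong_sym. Qed.
Lemma congb_trans : transitive congb.
Proof. move=> t s r /asboolP st /asboolP tr; exact/asboolP/(cong_trans st tr). Qed.

Canonical congb_equiv := EquivRel congb congb_refl congb_sym congb_trans.

Definition pmonoid := {eq_quot congb_equiv}.
HB.instance Definition _ := Choice.on pmonoid.
HB.instance Definition _ := EqQuotient.on pmonoid.

Definition wcl (s : seq A) : pmonoid := \pi_pmonoid s.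

Lemma wclP s t : wcl s = wcl t <-> cong s t.
Proof. by split=> [/eqmodP/asboolP|h]; last apply/eqmodP/asboolP. Qed.

Definition pmul (p q : pmonoid) : pmonoid := wcl (repr p ++ repr q).

Lemma cong_repr s : cong (repr (wcl s)) s.
Proof. by apply/wclP; rewrite /wcl reprK. Qed.

Lemma pmulE s t : pmul (wcl s) (wcl t) = wcl (s ++ t).
Proof. by apply/wclP/cong_cat; exact: cong_repr. Qed.

Lemma wcl_surj p : exists s, p = wcl s.
Proof. by exists (repr p); rewrite /wcl reprK. Qed.

Lemma pmulA : associative pmul.
Proof.
move=> p q r; have [s ->] := wcl_surj p; have [t ->] := wcl_surj q.
by have [z ->] := wcl_surj r; rewrite !pmulE catA.
Qed.
Lemma pmul1 : left_id (wcl [::]) pmul.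
Proof. by move=> p; have [s ->] := wcl_surj p; rewrite pmulE. Qed.
Lemma pmul1r : right_id (wcl [::]) pmul.
Proof. by move=> p; have [s ->] := wcl_surj p; rewrite pmulE cats0. Qed.

HB.instance Definition _ := isMonoid.Build pmonoid pmulA pmul1 pmul1r.

Lemma wclM s t : wcl (s ++ t) = wcl s * wcl t.
Proof. by rewrite -pmulE. Qed.

End PresentedMonoid.

Notation letter := bool.
Definition la : letter := true.
Definition lb : letter := false.

Definition onerel (u v s t : seq letter) : Prop := s = u /\ t = v.

Notation P u v := (pmonoid (onerel u v)).
Notation eltP u v := (wcl (onerel u v)).

(** The group is presented as a monoid, on the generators [(x, true)] (standing
    for [x]) and [(x, false)] (standing for [x^-1]). *)
Definition pos (s : seq letter) : seq (letter * bool) :=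
  [seq (x, true) | x <- s].

Variant grel (u v : seq letter) :
    seq (letter * bool) -> seq (letter * bool) -> Prop :=
| grel_uv : grel u v (pos u) (pos v)
| grel_inv x e : grel u v [:: (x, e); (x, ~~ e)] [::].

Section PresentedGroup.
Variables u v : seq letter.

Definition G := pmonoid (grel u v).
HB.instance Definition _ := Choice.on G.

Definition flip (s : seq (letter * bool)) : seq (letter * bool) :=
  rev [seq (x.1, ~~ x.2) | x <- s].

Lemma flipK : involutive flip.
Proof.
move=> s; rewrite /flip map_rev revK -map_comp map_id_in // => -[x e] _ /=.
by rewrite negbK.
Qed.

Lemma cong_flip s : cong (grel u v) (s ++ flip s) [::].
Proof.
elim: s => [|[x e] s ih]; first exact: cong_refl.
have -> : ((x, e) :: s) ++ flip ((x, e) :: s)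
        = [:: (x, e)] ++ (s ++ flip s) ++ [:: (x, ~~ e)].
  by rewrite /flip /= rev_cons -cats1 -catA.
apply: cong_trans (cong_cat2 _ _ ih) _ => /=.
exact: (@cong_rel _ _ [::] _ _ [::] (grel_inv u v x e)).
Qed.

Definition ginv (g : G) : G := wcl (grel u v) (flip (repr g)).

Lemma mulgVg : right_inverse (wcl (grel u v) [::]) ginv (@pmul _ (grel u v)).
Proof.
move=> g; rewrite /ginv -[X in pmul X _](reprK g) -/(wcl _ _) pmulE.
exact/wclP/cong_flip.
Qed.

Lemma mulVgg : left_inverse (wcl (grel u v) [::]) ginv (@pmul _ (grel u v)).
Proof.
move=> g; rewrite /ginv -[X in pmul _ X](reprK g) -/(wcl _ _) pmulE.
by apply/wclP; rewrite -{2}(flipK (repr g)); exact: cong_flip.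
Qed.

HB.instance Definition _ := isGroup.Build G
  (@pmulA _ (grel u v)) (@pmul1 _ (grel u v)) (@pmul1r _ (grel u v))
  mulVgg mulgVg.

Definition toG (p : P u v) : G := wcl (grel u v) (pos (repr p)).

Lemma cong_pos s t :
  cong (onerel u v) s t -> cong (grel u v) (pos s) (pos t).
Proof.
elim=> [r|r r' _|r r' r'' _ h _ h'|p r r' q [-> ->]].
- exact: cong_refl.
- exact: cong_sym.
- exact: cong_trans h h'.
- by rewrite /pos !map_cat; apply: cong_rel; exact: grel_uv.
Qed.

Lemma toG_wcl s : toG (eltP u v s) = wcl (grel u v) (pos s).
Proof. exact/wclP/cong_pos/cong_repr. Qed.

Lemma toGM p q : toG (p * q) = toG p * toG q.
Proof.
have [s ->] := wcl_surj p; have [t ->] := wcl_surj q.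
by rewrite -wclM !toG_wcl /pos map_cat wclM.
Qed.

End PresentedGroup.

Section Characters.
Variable M : monoidType.

Definition rideal (p : M) : set M := [set p * x | x in setT].

Definition right_LCM := forall p q : M,
  rideal p `&` rideal q = set0 \/ exists r, rideal p `&` rideal q = rideal r.

Definition left_reversible := forall p q : M, rideal p `&` rideal q !=set0.

Definition constructible : set (set M) :=
  [set S | S = set0 \/ exists p, S = rideal p].

Definition J := set_type constructible.
HB.instance Definition _ := Choice.on J.

Definition J0 : J := exist _ set0 (mem_set (or_introl erefl)).

Definition Jid (p : M) : J :=
  exist _ (rideal p) (mem_set (or_intror (ex_intro _ p erefl))).

(** Multiplicativity is required for those pairs whose intersection is again in
    [J]; these are all pairs exactly when [M] is right LCM. *)
Definition characters : set {ptws J -> bool} :=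
  [set chi | [/\ (forall b, exists S, chi S = b),
                 chi J0 = false
               & forall S T R : J, val R = val S `&` val T ->
                   chi R = chi S && chi T]].

Definition Omega := set_type characters.
HB.instance Definition _ := Topological.on Omega.

Definition ev (chi : Omega) (S : J) : bool := (val chi : J -> bool) S.

End Characters.

Section PrincipalCharacters.
Variable M : monoidType.

Lemma rideal_refl (p : M) : rideal p p.
Proof. by exists 1 => //; rewrite mulg1. Qed.

Lemma J_mulr (S : J M) (q r : M) : val S q -> val S (q * r).
Proof.
case: S => S /= /set_mem [->//|[p ->]] [x _ <-].
by exists (x * r) => //; rewrite mulgA.
Qed.

Definition chi_p_fun (p : M) : {ptws J M -> bool} :=
  fun S => `[< rideal p `<=` val S >].

Lemma chi_p_character p : characters (chi_p_fun p).
Proof.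
split=> [[]||S T R eR].
- by exists (Jid p); apply/asboolP.
- by exists (J0 M); apply/asboolP => /(_ p (rideal_refl p)).
- by apply/asboolP => /(_ p (rideal_refl p)).
- by rewrite /chi_p_fun eR -asbool_and; apply: asbool_equiv_eq; rewrite subsetI.
Qed.

Definition chi_p (p : M) : Omega M :=
  exist _ (chi_p_fun p) (mem_set (chi_p_character p)).

Definition Omega_infty : set (Omega M) := ~` range chi_p.

End PrincipalCharacters.

Section WordCharacters.
Variables (A : choiceType) (R : seq A -> seq A -> Prop).
Local Notation M := (pmonoid R).

(** [chi_w z] and [chi_inf z] are the characters [chi_z] of a finite and of an
    infinite word [z]. *)
Definition chi_w (z : seq A) : Omega M := chi_p (wcl R z).

Definition chi_inf_fun (z : nat -> A) : {ptws J M -> bool} :=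
  fun S => `[< exists n, val S (wcl R (mkseq z n)) >].

Lemma chi_inf_character z : characters (chi_inf_fun z).
Proof.
have mono (S : J M) m n : (m <= n)%N ->
    val S (wcl R (mkseq z m)) -> val S (wcl R (mkseq z n)).
  move=> /subnKC <-; rewrite /mkseq iotaD map_cat wclM.
  exact: J_mulr.
split=> [[]||S T U eU].
- by exists (Jid 1); apply/asboolP; exists 0%N; exact: rideal_refl.
- by exists (J0 M); apply/asboolP => -[].
- by apply/asboolP => -[].
- rewrite /chi_inf_fun eU -asbool_and; apply: asbool_equiv_eq.
  split=> [[n [Sn Tn]]|[[n Sn] [m Tm]]]; first by split; exists n.
  exists (maxn n m); split; first exact: mono (leq_maxl n m) Sn.
  exact: mono (leq_maxr n m) Tm.
Qed.

Definition chi_inf (z : nat -> A) : Omega M :=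
  exist _ (chi_inf_fun z) (mem_set (chi_inf_character z)).

End WordCharacters.

(** A groupoid is given by its space of arrows, the graph of the partially
    defined multiplication and the graph of the inversion. *)
Record top_groupoid := TopGroupoid {
  arrow : topologicalType;
  gmul : arrow -> arrow -> arrow -> Prop;
  ginverse : arrow -> arrow -> Prop }.

Definition top_groupoid_iso (H K : top_groupoid) (f : arrow H -> arrow K) :=
  [/\ bijective f,
      continuous f,
      (forall U : set (arrow H), open U -> open (f @` U)),
      (forall x y z, gmul x y z <-> gmul (f x) (f y) (f z))
    & (forall x y, ginverse x y <-> ginverse (f x) (f y))].

Section PartialAction.
Variables (M : monoidType) (Gr : groupType) (iota : M -> Gr).

(** [pact_dom g] is the domain [U_{g^-1}] of [g]. *)
Definition pact_dom (g : Gr) : set (Omega M) :=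
  [set chi | exists p q, g = iota p * (iota q)^-1 /\ ev chi (Jid q) = true].

Definition is_pact (g : Gr) (chi chi' : Omega M) : Prop :=
  exists p q, [/\ g = iota p * (iota q)^-1,
    ev chi (Jid q) = true,
    (forall x y, rideal x `&` rideal p = rideal (p * y) ->
       ev chi' (Jid x) = ev chi (Jid (q * y)))
  & (forall x, rideal x `&` rideal p = set0 -> ev chi' (Jid x) = false)].

(** The relation [is_pact g chi] does not depend on the choice of [p] and [q]
    and determines [g.chi] when [chi] is in [pact_dom g]; otherwise the value of
    [pact] is meaningless. *)
Definition pact (g : Gr) (chi : Omega M) : Omega M :=
  xget chi (is_pact g chi).

Variable Z : set (Omega M).

Definition pact_arrows : set (discrete_topology Gr * Omega M) :=
  [set a | [/\ pact_dom a.1 a.2, Z a.2 & Z (pact a.1 a.2)]].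

Definition pact_arrow := set_type pact_arrows.
HB.instance Definition _ := Topological.on pact_arrow.

(** [(g, chi)] has source [chi] and range [g.chi]. *)
Definition pact_groupoid : top_groupoid := @TopGroupoid pact_arrow
  (fun a b c => (val a).2 = pact (val b).1 (val b).2 /\
     val c = (((val a).1 : Gr) * (val b).1, (val b).2))
  (fun a b => val b = (((val a).1 : Gr)^-1, pact (val a).1 (val a).2)).

End PartialAction.

Record graph := Graph {
  vert : choiceType;
  edge : choiceType;
  rg : edge -> vert;
  sc : edge -> vert }.

Section Graph.
Variable E : graph.

(** A finite path is encoded by its range and the list of its edges, so that
    vertices are the paths with an empty list of edges. *)
Definition fpath := (vert E * seq (edge E))%type.

Fixpoint walk (x : vert E) (es : seq (edge E)) : bool :=
  if es is e :: es' then (rg e == x) && walk (sc e) es' else true.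

Definition is_fpath (mu : fpath) : bool := walk mu.1 mu.2.

Definition fsrc (mu : fpath) : vert E := last mu.1 [seq sc e | e <- mu.2].

Definition flen (mu : fpath) : nat := size mu.2.

Definition rawpath := (fpath + (nat -> edge E))%type.

Definition prng (z : rawpath) : vert E :=
  match z with inl mu => mu.1 | inr f => rg (f 0%N) end.

(** Concatenation [lambda z], meaningful when [fsrc lambda = prng z]. *)
Definition pcat (lambda : fpath) (z : rawpath) : rawpath :=
  match z with
  | inl mu => inl (lambda.1, lambda.2 ++ mu.2)
  | inr f => inr (fun i => if (i < flen lambda)%N then nth (f 0%N) lambda.2 i
                           else f (i - flen lambda)%N)
  end.

Definition is_boundary (z : rawpath) : Prop :=
  match z with
  | inl mu => is_fpath mu /\
      let r1 := [set e | rg e = fsrc mu] in r1 = set0 \/ infinite_set r1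
  | inr f => forall i, sc (f i) = rg (f i.+1)
  end.

Definition bdry := {z : rawpath | `[< is_boundary z >]}.
HB.instance Definition _ := Choice.on bdry.

Definition cylinder (mu : fpath) : set bdry :=
  [set x | exists2 z : bdry, prng (val z) = fsrc mu & val x = pcat mu (val z)].

(** These sets are stable under finite intersections up to the empty set, so
    they are a base of the topology that they generate. *)
Definition bdry_base : set (set bdry) :=
  [set U | exists (mu : fpath) (F : seq (edge E)),
    [/\ is_fpath mu, (forall e, e \in F -> rg e = fsrc mu)
      & U = cylinder mu `\`
              \bigcup_(e in [set` F]) cylinder (mu.1, rcons mu.2 e)]].

HB.instance Definition _ :=
  isSubBaseTopological.Build bdry bdry_base (fun U => U).

(** [is_triple t lambda mu zeta] :
    [t = (lambda zeta, l(lambda) - l(mu), mu zeta)]. *)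
Definition is_triple (t : bdry * int * bdry) (lambda mu : fpath) (zeta : bdry) :=
  [/\ is_fpath lambda /\ is_fpath mu,
      fsrc lambda = prng (val zeta) /\ fsrc mu = prng (val zeta),
      val t.1.1 = pcat lambda (val zeta),
      t.1.2 = ((flen lambda)%:Z - (flen mu)%:Z)%R
    & val t.2 = pcat mu (val zeta)].

Definition graph_arrow := {t : bdry * int * bdry |
  `[< exists lambda mu zeta, is_triple t lambda mu zeta >]}.
HB.instance Definition _ := Choice.on graph_arrow.

(** As above, these sets are a base of the topology that they generate. *)
Definition graph_arrow_base : set (set graph_arrow) :=
  [set U | exists (lambda mu : fpath) (V : set bdry),
    [/\ is_fpath lambda /\ is_fpath mu, fsrc lambda = fsrc mu, open V
      & U = [set t | exists2 zeta, V zeta & is_triple (val t) lambda mu zeta]]].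

HB.instance Definition _ :=
  isSubBaseTopological.Build graph_arrow graph_arrow_base (fun U => U).

(** [(x, n, y)] has source [y] and range [x]. *)
Definition graph_groupoid : top_groupoid := @TopGroupoid graph_arrow
  (fun a b c => (val a).2 = (val b).1.1 /\
     val c = ((val a).1.1, ((val a).1.2 + (val b).1.2)%R, (val b).2))
  (fun a b => val b = ((val a).2, (- (val a).1.2)%R, (val a).1.1)).

End Graph.

Section GraphModel.
Variables (u v : seq letter) (E : graph) (sigma : edge E -> letter).

Definition label (mu : fpath E) : seq letter := [seq sigma e | e <- mu.2].

Definition phi (x : bdry E) : Omega (P u v) :=
  match val x with
  | inl mu => chi_w (onerel u v) (label mu)
  | inr f => chi_inf (onerel u v) (fun i => sigma (f i))
  end.

(** The existence of [Phi] includes that [Phi] is well defined with values in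
    the groupoid of the partial action. *)
Definition graph_model (Z : set (Omega (P u v))) : Prop :=
  exists Phi : arrow (graph_groupoid E) -> arrow (pact_groupoid (@toG u v) Z),
    (forall (t : graph_arrow E) lambda mu zeta,
       is_triple (val t) lambda mu zeta ->
       val (Phi t) = (toG (eltP u v (label lambda)) *
                        (toG (eltP u v (label mu)))^-1,
                      phi (val t).2)) /\
    top_groupoid_iso Phi.

End GraphModel.

Section AvoidingWords.
Variable F : seq (seq letter).

Definition free_word (z : seq letter) : bool := all (fun x => ~~ infix x z) F.

Definition isubword (z : nat -> letter) (i n : nat) : seq letter :=
  mkseq (fun j => z (i + j)%N) n.

Definition free_inf (z : nat -> letter) : Prop :=
  forall x i, x \in F -> isubword z i (size x) <> x.

Variable L : nat.

Definition block_vert := {y : L.-tuple letter |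
  `[< exists z i, free_inf z /\ isubword z i L = y >]}.

Definition block_edge := {e : block_vert * block_vert |
  [exists s : letter, [exists t : letter,
     (rcons (val e.1) t == s :: val e.2) && free_word (rcons (val e.1) t)]]}.

Definition block_graph : graph :=
  @Graph block_vert block_edge (fun e => (val e).1) (fun e => (val e).2).

(** The first letter of the range of [e]; the default is irrelevant for [L > 0]. *)
Definition block_label (e : edge block_graph) : letter :=
  head la (val (val e).1).

End AvoidingWords.

Definition Yset (M : monoidType) (w : M) : set (Omega M) :=
  [set chi | Omega_infty chi /\ ev chi (Jid w) = false].

Definition standing_assumptions (u v : seq letter) : Prop :=
  [/\ u <> [::] /\ v <> [::], u <> v,
      (forall n, eltP u v [:: la] <> eltP u v (nseq n lb)) /\
      (forall n, eltP u v [:: lb] <> eltP u v (nseq n la)),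
      head la u <> head la v
    & last la u <> last la v].

(* Main.v *)
Require Import Defs.
From mathcomp Require Import finmap.
From mathcomp Require Import all_boot all_order all_algebra.
From mathcomp Require Import all_classical all_reals topology.
From mathcomp Require Import zify.

Set Implicit Arguments.
Unset Strict Implicit.
Unset Printing Implicit Defensive.

Local Open Scope classical_set_scope.
Local Open Scope group_scope.

(** Two factorisations of [w] give [a w = w x'] and [b w = w y'], so [w P] is a
    two-sided ideal; a word whose class lies outside [w P] has no subword with
    class in [w P]. A character in [Y] is a non-principal filter of elements
    outside [w P], and the point is that such filters are the same thing as the
    infinite words [z] avoiding the given finite list [F] of words. With
    [w = u = v], an element outside [w P] is represented by a single word,
    which is [u,v]-free, and a filter is just the set of prefixes of an
    infinite word. In the second situation [u] and [v] do not overlap, so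
    replacing an occurrence of [v] by [u] creates no new occurrence of [v];
    hence every element is represented by a [v]-free word. This word is not
    unique, but by the assumption on long words with different first letters,
    two long [v]-free words with a common multiple outside [w P] can differ
    only near their ends.

    Both cases are reduced to one criterion, [graph_model_criterion], with four
    hypotheses on the infinite [F]-free words: their prefixes stay outside
    [w P]; they are rigid (if the prefix of length [n + k] of [z] divides some
    prefix of [z'], then [z] and [z'] agree up to [n]); every infinite word
    [x z] with prefixes outside [w P] can be replaced by a free one, which
    continues a tail of [z] after an initial part of bounded length; and every
    character in [Y] comes from a free word. Rigidity makes [z |-> chi_z]
    injective with continuous inverse. Used twice, replacement shows that it is
    continuous, since whether [x] divides some prefix of [z] is then visible on
    a prefix of bounded length ([Free_decide]).

    On the graph side, each vertex of the block graph receives finitely many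
    edges and at least one, so the boundary consists of the infinite paths;
    these correspond to the infinite [F]-free words, and a basis of
    neighbourhoods is given by agreement on a prefix. An arrow is a pair of
    words [x], [y] with [x] shifted by [l] equal to [y] shifted by [m],
    together with [l - m]; it is sent to [p q^-1] and [chi_y], where [p] and
    [q] are the classes of the two prefixes. That this is an isomorphism rests
    on the embedding of the cancellative monoid [P] in [G] ([toG_inj]): the
    partial action does not depend on the fraction that represents a group
    element ([is_pact_unique]), it exchanges prefixes of infinite words
    ([is_pact_shift]), and the lag [l - m] can be read off the group element
    ([gval_inj]). *)

(** * Cancellation in the monoid *)

Section Cancellation.
Variables u v : seq letter.
Hypotheses (u0 : u <> [::]) (v0 : v <> [::]) (huv : head la u <> head la v).

Definition sides (x y : seq letter) := (x = u /\ y = v) \/ (x = v /\ y = u).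

Lemma sides_sym x y : sides x y -> sides y x.
Proof. by move=> [[-> ->]|[-> ->]]; [right|left]. Qed.

(** Derivations with their number of steps, the quantity that decreases in the
    proof of cancellation. *)
Inductive chain : nat -> seq letter -> seq letter -> Prop :=
| chain0 s : chain 0 s s
| chainS n p x y q t : sides x y -> chain n (p ++ y ++ q) t ->
    chain n.+1 (p ++ x ++ q) t.

Lemma chain_cat m n s t r : chain m s t -> chain n t r -> chain (m + n) s r.
Proof.
elim=> // k p x y q t' xy _ ih h; rewrite addSn; exact: chainS xy (ih h).
Qed.

Lemma chain_pre n p s t : chain n s t -> chain n (p ++ s) (p ++ t).
Proof.
elim=> [s'|k p' x y q t' xy _ ih]; first exact: chain0.
by rewrite catA; apply: (chainS xy); rewrite -catA.
Qed.

Lemma chain_sym n s t : chain n s t -> chain n t s.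
Proof.
elim=> [s'|k p x y q t' xy _ ih]; first exact: chain0.
rewrite -addn1; apply: chain_cat ih _.
exact: chainS (sides_sym xy) (chain0 _).
Qed.

Lemma cong_chain s t : cong (onerel u v) s t <-> exists n, chain n s t.
Proof.
split=> [|[n]].
  elim=> [r|r r' _ [n h]|r r' r'' _ [n h] _ [m h']|p r r' q [-> ->]].
  - by exists 0%N; exact: chain0.
  - by exists n; exact: chain_sym.
  - by exists (n + m)%N; exact: chain_cat h h'.
  - by exists 1%N; apply: chainS (chain0 _); left.
elim=> [r|k p x y q r xy _ h]; first exact: cong_refl.
apply: cong_trans h.
case: xy => -[-> ->]; first exact: cong_rel.
by apply: cong_sym; exact: cong_rel.
Qed.

(** The derivation is cut at its first step applied at the front of the word:
    the steps before it take place behind the first letter. *)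
Lemma chain_first n c s r : chain n (c :: s) r ->
  (exists2 t, r = c :: t & chain n s t) \/
  (exists k m x y q, [/\ sides (c :: x) y, chain k s (x ++ q),
     chain m (y ++ q) r & (k + m).+1 = n]).
Proof.
move: {2 3}(c :: s) (erefl (c :: s)) => cs e h.
elim: h c s e => [_ c s <-|k p x y q t xy h ih c s].
  by left; exists s => //; exact: chain0.
case: p h ih => [|d p] h ih /=.
  case: x xy => [[[]|[]]|d x] => [/esym//|/esym//|xy /= [-> ->]].
  by right; exists 0%N, k, x, y, q; split=> //; exact: chain0.
move=> [dc es]; subst d.
have [[t' -> h']|[k1 [m [x' [y' [q' [s1 s2 s3 <-]]]]]]] := ih _ _ erefl.
  by left; exists t' => //; rewrite es; exact: chainS xy h'.
right; exists k1.+1, m, x', y', q'; split=> //; rewrite es.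
exact: chainS xy s2.
Qed.

(** A derivation from [c s] to [c t] that changes the first letter starts with
    the side of the relation beginning with [c] and must later change it back.
    Between these two steps the word keeps the other side of the relation as a
    prefix; by induction that prefix cancels, and the two steps can be
    dropped. *)
Lemma chain_cancel n c s t : chain n (c :: s) (c :: t) ->
  exists2 m, (m <= n)%N & chain m s t.
Proof.
elim/ltn_ind: n c s t => n ih c s t.
have ihw k p s' t' : (k < n)%N -> chain k (p ++ s') (p ++ t') ->
    exists2 m, (m <= k)%N & chain m s' t'.
  elim: p k => [|d p ihp] k kn; first by exists k.
  move=> /(ih _ kn) [m mk /ihp [|m' m'm h]]; first exact: leq_ltn_trans kn.
  by exists m' => //; exact: leq_trans mk.
move=> /chain_first [[t' [->] h]|[k [m [x [y [q [xy h1 h2 nE]]]]]]].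
  by exists n.
case: y xy h2 => [|d y xy /chain_first]; first by case=> -[_ /esym].
have dc : d <> c by case: xy => -[xE yE] dc; apply: huv; rewrite -xE -yE /= dc.
move=> [[t' [/esym/dc//]]|[k' [m' [y' [x' [q' [xy' h2 h3 mE]]]]]]].
have [yE xE] : y' = y /\ x' = c :: x.
  have cx : d :: y' <> c :: x by case=> /dc.
  case: xy => -[e1 e2]; case: xy' => -[e3 e4];
    try by case: cx; rewrite e1 e3.
    by move: e3; rewrite e4 e1 -e2 => -[].
  by move: e3; rewrite e4 e1 -e2 => -[].
subst y' x'.
have [||j jk' h4] := ihw k' y q q'; [|exact: h2|].
  lia.
have h : chain (k + j + m') (c :: s) (c :: t).
  apply: chain_cat h3.
  apply: (@chain_pre _ [:: c]); apply: chain_cat h1 _.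
  exact: chain_pre.
have lt : (k + j + m' < n)%N by lia.
have [m1 m1le hh] := ih _ lt _ _ _ h.
by exists m1 => //; apply: leq_trans m1le (ltnW lt).
Qed.

Lemma wcl_cancel p s t :
  eltP u v (p ++ s) = eltP u v (p ++ t) -> eltP u v s = eltP u v t.
Proof.
elim: p => // c p ih /wclP/cong_chain [n /chain_cancel [m _ h]].
by apply: ih; apply/wclP/cong_chain; exists m.
Qed.

Lemma wcl_nil s : eltP u v s = eltP u v [::] -> s = [::].
Proof.
move=> /wclP/cong_chain [n h]; set e := [::] in h.
have eE : e = [::] by []; elim: h eE => // k p x y q t xy _ ih /ih {ih}.
case: p => //=; case: y xy => // -[[_ e1]|[_ e1]] _; by [case: v0|case: u0].
Qed.

End Cancellation.

Lemma cong_rev u v s t : cong (onerel u v) s t ->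
  cong (onerel (rev u) (rev v)) (rev s) (rev t).
Proof.
elim=> [r|r r' _|r r' r'' _ h _ h'|p r r' q [-> ->]].
- exact: cong_refl.
- exact: cong_sym.
- exact: cong_trans h h'.
- by rewrite !rev_cat -!catA; exact: cong_rel.
Qed.

Section Cancellative.
Variables u v : seq letter.
Hypothesis huv : standing_assumptions u v.
Local Notation M := (P u v).
Implicit Types p q r : M.

Lemma pmul_cancell p q r : p * q = p * r -> q = r.
Proof.
have [[u0 v0] _ _ hd _] := huv.
have [s ->] := wcl_surj p; have [t ->] := wcl_surj q.
by have [z ->] := wcl_surj r; rewrite -!wclM => /(wcl_cancel u0 v0 hd).
Qed.

(** Right cancellation is left cancellation for the reversed relation. *)
Lemma pmul_cancelr p q r : q * p = r * p -> q = r.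
Proof.
have [[u0 v0] _ _ _ hl] := huv.
have [s ->] := wcl_surj p; have [t ->] := wcl_surj q.
have [z ->] := wcl_surj r; rewrite -!wclM => /wclP/cong_rev.
rewrite !rev_cat => /wclP h.
have rv0 x : x <> [::] -> rev x <> [::] :> seq letter.
  by move=> x0 /(congr1 rev); rewrite revK.
have hr (x : seq letter) : head la (rev x) = last la x.
  by case/lastP: x => // x c; rewrite rev_rcons last_rcons.
have hd : head la (rev u) <> head la (rev v) by rewrite !hr.
have /wclP/cong_rev := wcl_cancel (rv0 _ u0) (rv0 _ v0) hd h.
by rewrite !revK => /wclP.
Qed.

Lemma wcl_eq1 s : eltP u v s = 1 -> s = [::].
Proof. by have [[u0 v0] _ _ _ _] := huv; exact: wcl_nil. Qed.

Lemma pmul_eq1 p q : p * q = 1 -> p = 1.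
Proof.
have [s ->] := wcl_surj p; have [t ->] := wcl_surj q; rewrite -wclM.
by move=> /wcl_eq1; case: s.
Qed.

End Cancellative.

(** * Embedding of the monoid in its group *)

Lemma eltP_uv u v : eltP u v u = eltP u v v.
Proof.
have uv : onerel u v u v by [].
by apply/wclP; have := cong_rel [::] [::] uv; rewrite /= !cats0.
Qed.

Section OreEmbedding.
Variables u v : seq letter.
Hypothesis huv : standing_assumptions u v.
Hypothesis hrev : left_reversible (P u v).
Local Notation M := (P u v).
Implicit Types (p q r : M) (f : M * M).

Lemma common_multiple p q : exists s t, p * s = q * t.
Proof. by have [r [[s _ sr] [t _ tr]]] := hrev p q; exists s, t;
  rewrite sr. Qed.

(** A pair [(p, q)] stands for [p q^-1]. *)
Definition frac_eq f f' := exists s t, f.1 * s = f'.1 * t /\ f.2 * s = f'.2 * t.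

Lemma frac_refl f : frac_eq f f.
Proof. by exists 1, 1. Qed.

Lemma frac_sym f f' : frac_eq f f' -> frac_eq f' f.
Proof. by move=> [s [t [h1 h2]]]; exists t, s. Qed.

Lemma frac_trans f f' f'' : frac_eq f f' -> frac_eq f' f'' -> frac_eq f f''.
Proof.
move=> [s [t [h1 h2]]] [s' [t' [h3 h4]]].
have [a [b ab]] := common_multiple t s'.
by exists (s * a), (t' * b); rewrite !mulgA h1 h2 -h3 -h4 -!mulgA ab.
Qed.

Lemma frac_mull m p q p' q' :
  frac_eq (m * p, q) (m * p', q') <-> frac_eq (p, q) (p', q').
Proof.
split=> -[s [t [/= h1 h2]]]; exists s, t; split=> //=.
  by apply: (pmul_cancell huv (p := m)); rewrite !mulgA.
by rewrite -!mulgA h1.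
Qed.

(** Left multiplication of fractions by a group word. As a relation between
    pairs it needs neither the quotient by [frac_eq] nor a choice of common
    multiples. *)
Fixpoint gact (g : seq (letter * bool)) f f' : Prop :=
  if g is (x, e) :: g' then
    exists2 f1, gact g' f f1 &
      if e then frac_eq f' (eltP u v [:: x] * f1.1, f1.2)
      else frac_eq f1 (eltP u v [:: x] * f'.1, f'.2)
  else frac_eq f f'.

Lemma gact_eqr g f f1 f2 : frac_eq f1 f2 -> gact g f f1 -> gact g f f2.
Proof.
case: g => [|[x e] g] /=; first by move=> h h'; exact: frac_trans h' h.
move=> h [f' fg fe]; exists f' => //; case: e fe => fe.
  exact: frac_trans (frac_sym h) fe.
apply: frac_trans fe _; apply/frac_mull.
by case: f1 f2 h {fg} => ? ? [].
Qed.

Lemma gact_cat g h f f' :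
  gact (g ++ h) f f' <-> exists2 f1, gact h f f1 & gact g f1 f'.
Proof.
elim: g f' => [|[x e] g ih] f' /=.
  split=> [hf|[f1 hf e1]]; last exact: gact_eqr e1 hf.
  by exists f' => //; exact: frac_refl.
split=> [[f1 /ih [f2 h1 h2] h3]|[f2 h1 [f1 h2 h3]]].
  by exists f2 => //; exists f1.
by exists f1 => //; apply/ih; exists f2.
Qed.

Lemma gact_pos s f f' : gact (pos s) f f' <-> frac_eq (eltP u v s * f.1,
  f.2) f'.
Proof.
elim: s f' => [|x s ih] f' /=; first by rewrite (_ : eltP u v [::]
  = 1) // mul1g; case: f.
rewrite -[x :: s]cat1s wclM -mulgA; split.
  move=> [[p q] /ih h h']; apply: frac_trans (frac_sym h').
  exact/frac_mull.
move=> h; exists (eltP u v s * f.1, f.2); first exact/ih/frac_refl.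
exact: frac_sym.
Qed.

(** Letters act injectively on fractions by cancellation and surjectively by the
    existence of common multiples, so that inverse letters act as inverses. *)
Lemma gact_cong g g' f f' :
  cong (Defs.grel u v) g g' -> gact g f f' <-> gact g' f f'.
Proof.
move=> gg; elim: gg f f' => [r|r r' _ ih|r r' r'' _ h1 _ h2|p g1 g2 q h12] f f'.
- by [].
- by rewrite ih.
- by rewrite h1 h2.
suff g12 f1 f2 : gact g1 f1 f2 <-> gact g2 f1 f2.
  split=> /gact_cat [f1 /gact_cat [f2 h1 h2] h3];
    by apply/gact_cat; exists f1 => //; apply/gact_cat; exists f2 => //;
      apply/g12.
case: h12 => [|x [|]].
- by rewrite !gact_pos eltP_uv.
- rewrite /=; split=> [[[p1 q1] [[p2 q2] h1 h2] h3]|h1].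
    apply: frac_trans h1 _; apply: frac_trans h2 _; exact: frac_sym.
  have [s [t st]] := common_multiple f1.1 (eltP u v [:: x]).
  have h : frac_eq f1 (eltP u v [:: x] * t, f1.2 * s).
    by exists s, 1; rewrite !mulg1 /= st.
  exists (t, f1.2 * s); last exact: frac_trans (frac_sym h1) h.
  by exists f1 => //; exact: frac_refl.
- rewrite /=; split=> [[[p1 q1] [[p2 q2] h1 h2] h3]|h1].
    apply: frac_trans h1 _; case: f2 h3 => a b h3.
    by apply/frac_mull; apply: frac_trans (frac_sym h2) h3.
  exists (eltP u v [:: x] * f1.1, f1.2).
    by exists f1; exact: frac_refl.
  by apply/frac_mull; case: f1 f2 h1 => ? ? [].
Qed.

(** The action on the fraction [1 / 1] recovers [p] from its image in the
    group. *)
Lemma toG_inj : injective (@toG u v).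
Proof.
move=> p q; have [s ->] := wcl_surj p; have [t ->] := wcl_surj q.
rewrite !toG_wcl => /wclP st.
have /(gact_cong _ _ st)/gact_pos : gact (pos s) (1, 1) (eltP u v s, 1).
  by apply/gact_pos; rewrite mulg1; exact: frac_refl.
rewrite /= mulg1 => -[m [n [/= h1]]]; rewrite !mul1g => mn.
by apply: (pmul_cancelr huv (p := n)); rewrite -h1 mn.
Qed.

Local Notation iota := (@toG u v).

Lemma frac_toG p q p' q' : iota p * (iota q)^-1 = iota p' * (iota q')^-1 ->
  forall s t, q * s = q' * t -> p * s = p' * t.
Proof.
move=> pq s t st; apply: toG_inj; rewrite !toGM.
rewrite -[iota p](mulgVK (iota q)) pq -mulgA -(toGM q) st toGM.
by rewrite mulgA mulgVK.
Qed.

End OreEmbedding.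

(** * Infinite words *)

Section InfiniteWords.
Implicit Types (s t : seq letter) (z : nat -> letter).

Definition wcat s z : nat -> letter :=
  fun i => if (i < size s)%N then nth la s i else z (i - size s)%N.

Definition wshift n z : nat -> letter := fun i => z (n + i)%N.

Lemma mkseq_wcat s z n : mkseq (wcat s z) (size s + n) = s ++ mkseq z n.
Proof.
apply: (@eq_from_nth _ la) => [|i]; rewrite ?size_cat !size_mkseq // => ilt.
rewrite nth_mkseq // nth_cat /wcat; case: ltnP => // si.
by rewrite nth_mkseq //; lia.
Qed.

Lemma mkseq_wcat_take s z n : (n <= size s)%N -> mkseq (wcat s z) n = take n s.
Proof.
move=> ns; have sn : size (take n s) = n by rewrite size_takel.
apply: (@eq_from_nth _ la) => [|i]; rewrite size_mkseq ?sn // => ilt.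
by rewrite nth_mkseq // nth_take // /wcat (leq_trans ilt).
Qed.

Lemma mkseqD z m n : mkseq z (m + n) = mkseq z m ++ mkseq (wshift m z) n.
Proof.
apply: (@eq_from_nth _ la) => [|i]; rewrite ?size_cat !size_mkseq // => ilt.
rewrite nth_mkseq // nth_cat size_mkseq; case: ltnP => h; rewrite nth_mkseq //.
  by rewrite /wshift subnKC.
lia.
Qed.

Lemma wcat_mkseq z n : wcat (mkseq z n) (wshift n z) = z.
Proof.
apply/funext => i; rewrite /wcat /wshift size_mkseq.
by case: ltnP => h; [rewrite nth_mkseq|rewrite subnKC].
Qed.

Lemma wshift_wcat s z : wshift (size s) (wcat s z) = z.
Proof. by apply/funext => i; rewrite /wshift /wcat ltnNge leq_addr addKn. Qed.

Lemma wshiftD m n z : wshift m (wshift n z) = wshift (n + m) z.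
Proof. by apply/funext => i; rewrite /wshift addnA. Qed.

Lemma eq_mkseq_le z z' m n : (m <= n)%N ->
  mkseq z n = mkseq z' n -> mkseq z m = mkseq z' m.
Proof. by move=> mn /(congr1 (take m)); rewrite /mkseq -!map_take !take_iota
  (minn_idPl mn). Qed.

Lemma mkseq_inj z z' : (forall n, mkseq z n = mkseq z' n) -> z = z'.
Proof.
move=> h; apply/funext => i; have /(congr1 (nth la ^~ i)) := h i.+1.
by rewrite !nth_mkseq.
Qed.

End InfiniteWords.

(** * Characters as filters, and the partial action *)

Section Filters.
Variables u v : seq letter.
Hypothesis huv : standing_assumptions u v.
Hypothesis hlcm : right_LCM (P u v).
Hypothesis hrev : left_reversible (P u v).
Local Notation M := (P u v).
Local Notation iota := (@toG u v).
Implicit Types (p q r x y : M) (chi : Omega M) (s t c : seq letter).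

Lemma ridealP p x : rideal p x <-> exists y, x = p * y.
Proof. by split=> [[y _ <-]|[y ->]]; exists y. Qed.

Lemma ridealMr p q : rideal p (p * q).
Proof. by exists q. Qed.

Lemma rideal_mulr p x y : rideal p x -> rideal p (x * y).
Proof. by move=> [z _ <-]; rewrite -mulgA; exact: ridealMr. Qed.

Lemma rideal_trans p q r : rideal p q -> rideal q r -> rideal p r.
Proof. by move=> pq [z _ <-]; exact: rideal_mulr. Qed.

Lemma rideal_mull m p x : rideal (m * p) (m * x) <-> rideal p x.
Proof.
split=> [[y _]|[y _ <-]]; last by rewrite mulgA; exact: ridealMr.
by rewrite -mulgA => /(pmul_cancell huv) <-; exact: ridealMr.
Qed.

Lemma lcm_ex p q : exists r, rideal p `&` rideal q = rideal r.
Proof.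
have [e|//] := hlcm p q.
by have := hrev p q; rewrite e => -[].
Qed.

Lemma Omega_ext chi chi' :
  (forall x, ev chi (Jid x) = ev chi' (Jid x)) -> chi = chi'.
Proof.
move=> h; apply: val_inj; apply/funext => S.
have [SE|[x SE]] := set_mem (valP S).
  have -> : S = J0 M by exact: val_inj.
  have [_ -> _] := set_mem (valP chi); by have [_ -> _] := set_mem (valP chi').
have -> : S = Jid x by exact: val_inj.
exact: h.
Qed.

Lemma ev_meet chi p q r : rideal p `&` rideal q = rideal r ->
  ev chi (Jid r) = ev chi (Jid p) && ev chi (Jid q).
Proof. by have [_ _ h] := set_mem (valP chi) => e; apply: h; rewrite /= e. Qed.

Lemma ev_mono chi x p : rideal x p -> ev chi (Jid p) -> ev chi (Jid x).
Proof.
move=> xp; rewrite (@ev_meet chi x p p) => [/andP[]//|].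
by apply/seteqP; split=> [y []//|y py]; split=> //; exact: rideal_trans py.
Qed.

Lemma ev_lcm chi p q : ev chi (Jid p) -> ev chi (Jid q) ->
  exists r, [/\ rideal p `&` rideal q = rideal r, rideal p r, rideal q r
              & ev chi (Jid r)].
Proof.
move=> hp hq; have [r rE] := lcm_ex p q; exists r.
have [pr qr] : (rideal p `&` rideal q) r by rewrite rE; exact: rideal_refl.
by split=> //; rewrite (ev_meet chi rE) hp hq.
Qed.

Lemma ev_chi_p p x : ev (chi_p p) (Jid x) <-> rideal x p.
Proof.
split=> [/asboolP|xp]; first by apply; exact: rideal_refl.
by apply/asboolP => y; exact: rideal_trans.
Qed.

Lemma ev_chi_inf (z : nat -> letter) x :
  ev (chi_inf (onerel u v) z) (Jid x) <-> exists n,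
    rideal x (eltP u v (mkseq z n)).
Proof. by split=> [/asboolP|h]; last exact/asboolP. Qed.

Lemma rideal_mkseq (z : nat -> letter) x m n : (m <= n)%N ->
  rideal x (eltP u v (mkseq z m)) -> rideal x (eltP u v (mkseq z n)).
Proof. by move=> /subnKC <-; rewrite mkseqD wclM; exact: rideal_mulr. Qed.

Lemma ev_chi_inf_cat s (z : nat -> letter) x :
  ev (chi_inf (onerel u v) (wcat s z)) (Jid x) <->
  exists n, rideal x (eltP u v s * eltP u v (mkseq z n)).
Proof.
rewrite ev_chi_inf; split=> -[n h].
  exists n; rewrite -wclM -mkseq_wcat; apply: rideal_mkseq h; exact: leq_addl.
by exists (size s + n)%N; rewrite mkseq_wcat wclM.
Qed.

(** The partial action exchanges prefixes of infinite words: cancelling [s] or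
    [t], either side says that some prefix of [z] is a multiple of [y]. *)
Lemma is_pact_shift s t (z : nat -> letter) :
  is_pact iota (iota (eltP u v s) * (iota (eltP u v t))^-1)
    (chi_inf (onerel u v) (wcat t z)) (chi_inf (onerel u v) (wcat s z)).
Proof.
exists (eltP u v s), (eltP u v t); split=> //.
- by apply/ev_chi_inf_cat; exists 0%N; exact: ridealMr.
- move=> x y e; apply/idP/idP => /ev_chi_inf_cat [n h]; apply/ev_chi_inf_cat.
    exists n; apply/rideal_mull.
    by rewrite -(rideal_mull (eltP u v s)) -e; split=> //; exact: ridealMr.
  exists n; have [] // : (rideal x `&` rideal (eltP u v s))
                       (eltP u v s * eltP u v (mkseq z n)).
  by rewrite e; apply/rideal_mull; exact: (iffLR (rideal_mull _ _ _) h).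
- by move=> x e; have := hrev x (eltP u v s); rewrite e => -[].
Qed.

(** Let [x P] meet [p P] in [p y P]. By cancellation [q y P] meets [q s P] in
    [q s z P], and as [q s] is in the filter the character takes the same value
    on [q y P] and on [q s z P]. *)
Lemma pact_rep_refine g chi chi' p q (s : M) x (z : M) :
  g = iota p * (iota q)^-1 ->
  (forall x y, rideal x `&` rideal p = rideal (p * y) ->
       ev chi' (Jid x) = ev chi (Jid (q * y))) ->
  ev chi (Jid (q * s)) ->
  rideal x `&` rideal (p * s) = rideal (p * s * z) ->
  ev chi' (Jid x) = ev chi (Jid (q * s * z)).
Proof.
move=> gE h qs e; have [r rE] := lcm_ex x p.
have [xr [y _ yr]] : (rideal x `&` rideal p) r by rewrite rE;
  exact: rideal_refl.
rewrite -yr in rE; rewrite (h _ _ rE).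
rewrite (@ev_meet chi (q * y) (q * s) (q * s * z)) ?qs ?andbT //.
suff eys : rideal y `&` rideal s = rideal (s * z).
  apply/seteqP; split=> [k [[a _ aE] [b _ bE]]|k].
    have /(pmul_cancell huv) ab : q * (y * a) = q * (s * b).
      by rewrite !mulgA aE bE.
    have [d _ dE] : rideal (s * z) (y * a).
      by rewrite -eys; split; [|rewrite ab]; exact: ridealMr.
    by rewrite -aE -[q * y * a]mulgA -dE -!mulgA; apply/rideal_mull;
      rewrite mulgA; exact: ridealMr.
  have [yz sz] : (rideal y `&` rideal s) (s * z) by rewrite eys;
    exact: rideal_refl.
  rewrite -mulgA => hk; split; apply: rideal_trans hk; exact/rideal_mull.
apply/seteqP; split=> [k [yk sk]|k].
  apply/(rideal_mull p); rewrite mulgA -e; split; last exact/rideal_mull.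
  have [] // : (rideal x `&` rideal p) (p * k).
  by rewrite rE; exact/rideal_mull.
move=> /(rideal_mull p); rewrite mulgA -e => -[xk sk]; split.
  by apply/(rideal_mull p); rewrite -rE; split=> //; exact: ridealMr.
by apply/(rideal_mull p).
Qed.

(** Two fractions for the same group element have a common refinement, given by
    the least common multiple of their denominators; this multiple is in the
    filter if both denominators are. *)
Lemma is_pact_unique g chi chi1 chi2 :
  is_pact iota g chi chi1 -> is_pact iota g chi chi2 -> chi1 = chi2.
Proof.
move=> [p [q [gE qchi h1 _]]] [p' [q' [gE' qchi' h2 _]]].
have [r [rE [s _ sr] [t _ tr] rchi]] := ev_lcm qchi qchi'.
have pE : p * s = p' * t.
  apply: (frac_toG huv hrev (q := q) (q' := q')); last by rewrite sr tr.
  by rewrite -gE.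
apply: Omega_ext => x; have [k kE] := lcm_ex x (p * s).
have [_ [z _ zk]] : (rideal x `&` rideal (p * s)) k by rewrite kE;
  exact: rideal_refl.
rewrite -zk in kE.
rewrite (pact_rep_refine gE h1 _ kE) ?sr //.
by rewrite pE in kE; rewrite (pact_rep_refine gE' h2 _ kE) ?tr.
Qed.

Lemma pactE g chi chi' : is_pact iota g chi chi' -> pact iota g chi = chi'.
Proof.
move=> h; rewrite /pact; case: xgetP => [chi1 _ h1|/(_ _ h)//].
exact: is_pact_unique h1 h.
Qed.

(** Enumerating all words and extending a word of [Q] so that it becomes a
    multiple of each enumerated element of the filter gives an increasing
    sequence of words that is cofinal in the filter. As the character is not
    principal, each extension can be taken proper, and the limit is an infinite
    word. *)
Lemma chi_inf_of_chain chi (Q : set (seq letter)) c0 :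
  Omega_infty chi -> Q c0 -> (forall c, Q c -> ev chi (Jid (eltP u v c))) ->
  (forall c p, Q c -> ev chi (Jid p) ->
     exists e, Q (c ++ e) /\ rideal p (eltP u v (c ++ e))) ->
  exists z, chi = chi_inf (onerel u v) z /\
    forall n, exists2 c, Q c & prefix (mkseq z n) c.
Proof.
move=> chiinf Q0 Qev Qext.
have [f fP] : exists f : nat -> seq letter -> seq letter, forall n c, Q c ->
    [/\ f n c <> [::], Q (c ++ f n c)
      & forall s, unpickle n = Some s -> ev chi (Jid (eltP u v s)) ->
        rideal (eltP u v s) (eltP u v (c ++ f n c))].
  have h (nc : nat * seq letter) : exists e, Q nc.2 -> [/\ e <> [::],
    Q (nc.2 ++ e)
      & forall s, unpickle nc.1 = Some s -> ev chi (Jid (eltP u v s)) ->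
        rideal (eltP u v s) (eltP u v (nc.2 ++ e))].
    case: nc => n c /=; have [Qc|] := pselect (Q c); last by exists [::].
    have [p pchi pc] : exists2 p, ev chi (Jid p) & ~ rideal p (eltP u v c).
      apply: contrapT => hn; apply: chiinf; exists (eltP u v c) => //.
      apply: Omega_ext => x; apply/idP/idP => [/ev_chi_p xc|xchi].
        exact: ev_mono xc (Qev _ Qc).
      by apply/ev_chi_p; apply: contrapT => xc; apply: hn; exists x.
    have [q [pq qchi hq]] : exists q, [/\ rideal p q, ev chi (Jid q)
       & forall s, unpickle n = Some s -> ev chi (Jid (eltP u v s)) ->
          rideal (eltP u v s) q].
      case: (unpickle n) => [s|]; last by exists p; split=> //;
        exact: rideal_refl.
      have [schi|schi] := boolP (ev chi (Jid (eltP u v s))).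
        have [q [_ pq sq qchi]] := ev_lcm pchi schi.
        by exists q; split=> // _ [<-].
      exists p; split=> //; first exact: rideal_refl.
      by move=> _ [<-]; rewrite (negbTE schi).
    have [e [Qe qe]] := Qext _ _ Qc qchi; exists e => _; split=> //.
      by move=> e0; apply: pc; move: qe; rewrite e0 cats0; exact: rideal_trans.
    by move=> s sn schi; apply: rideal_trans qe; exact: hq.
  have [f fP] := choice h; exists (fun n c => f (n, c)) => n c;
    exact: (fP (n, c)).
have [C [C0 CS]] : exists C, C 0%N = c0 /\ forall n, C n.+1 = C n ++ f n (C n).
  by exists (fun n => iteri n (fun n c => c ++ f n c) c0).
have CQ n : Q (C n) by elim: n => [|n /(fP n)[]]; rewrite ?C0 ?CS.
have Csz n : (n <= size (C n))%N.
  elim: n => // n ih; rewrite CS size_cat.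
  have [] := fP n _ (CQ n); case: (f n (C n)) => //= *; lia.
have Cpre m n : (m <= n)%N -> prefix (C m) (C n).
  move=> /subnKC <-; elim: (n - m)%N => [|k ih];
    rewrite ?addn0 ?addnS ?prefix_refl //.
  by apply: prefix_trans ih _; rewrite CS prefix_prefix.
pose z i := nth la (C i.+1) i.
have zC n : mkseq z n = take n (C n).
  apply: (@eq_from_nth _ la) => [|i]; rewrite size_mkseq ?size_takel // => ilt.
  rewrite nth_mkseq // nth_take // /z.
  have /prefixP [r ->] := Cpre _ _ ilt.
  by rewrite nth_cat Csz.
exists z; split; last first.
  by move=> n; exists (C n) => //; rewrite zC -[X in prefix _ X](cat_take_drop
    n) prefix_prefix.
apply: Omega_ext => x; apply/idP/idP => [xchi|/ev_chi_inf [n]]; last first.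
  rewrite zC => h; apply: ev_mono (Qev _ (CQ n)).
  by rewrite -(cat_take_drop n (C n)) wclM; exact: rideal_mulr.
have [s sx] := wcl_surj x; apply/ev_chi_inf.
pose k := pickle s; pose N := size (C k.+1).
have [_ _ h] := fP k _ (CQ k); exists N.
have -> : mkseq z N = C k.+1.
  rewrite zC; have /prefixP [r ->] := Cpre _ _ (Csz k.+1).
  by rewrite take_size_cat.
by rewrite sx CS; apply: h; rewrite ?pickleK -?sx.
Qed.

End Filters.

(** * Rigid families of infinite words *)

Section WordModel.
Variables u v : seq letter.
Hypothesis huv : standing_assumptions u v.
Local Notation M := (P u v).
Local Notation cl := (eltP u v).
Local Notation chiw := (chi_inf (onerel u v)).

Variables (w : M) (Free : set (nat -> letter)).
Hypothesis w_two_sided : forall p x, rideal w x -> rideal w (p * x).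
Hypothesis Free_shift : forall z n, Free z -> Free (wshift n z).
Hypothesis Free_w : forall z n, Free z -> ~ rideal w (cl (mkseq z n)).
Hypothesis Free_rigid : exists k, forall z z' n, Free z -> Free z' ->
  ev (chiw z') (Jid (cl (mkseq z (n + k)))) -> mkseq z' n = mkseq z n.
Hypothesis Free_replace : forall x : M, exists N, forall z, Free z ->
  (forall n, ~ rideal w (x * cl (mkseq z n))) ->
  exists h i, [/\ (size h <= N)%N, cl h = x * cl (mkseq z i)
                & Free (wcat h (wshift i z))].

Lemma ev_chi_replace (x y : M) h i (z : nat -> letter) :
  cl h = x * cl (mkseq z i) ->
  ev (chiw (wcat h (wshift i z))) (Jid y) <->
  exists n, rideal y (x * cl (mkseq z n)).
Proof.
move=> hE; rewrite ev_chi_inf_cat; split=> -[n].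
  by rewrite hE -mulgA -wclM -mkseqD => ?; exists (i + n)%N.
move=> h1; exists n; rewrite hE -mulgA -wclM -mkseqD addnC mkseqD wclM mulgA.
exact: rideal_mulr.
Qed.

Lemma Free_inj z z' : Free z -> Free z' -> chiw z = chiw z' -> z = z'.
Proof.
move=> fz fz' e; have [k hk] := Free_rigid.
apply: mkseq_inj => n; apply: hk => //; rewrite e; apply/ev_chi_inf.
exists (n + k)%N; exact: rideal_refl.
Qed.

(** If [chi_z] were principal, a prefix of [z]
  and the next one would divide each
    other, and a letter would be a unit. *)
Lemma Free_Yset z : Free z -> Yset w (chiw z).
Proof.
move=> fz; split; last first.
  by apply/negP => /ev_chi_inf [n]; exact: Free_w.
move=> [p _ pz].
have /ev_chi_inf [m /ridealP [q qE]] : ev (chiw z) (Jid p).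
  by rewrite -pz; apply/ev_chi_p; exact: rideal_refl.
have : ev (chiw z) (Jid (cl (mkseq z m.+1))).
  by apply/ev_chi_inf; exists m.+1; exact: rideal_refl.
rewrite -pz => /ev_chi_p /ridealP [r rE].
have : p * (q * (cl [:: z m] * r)) = p * 1.
  rewrite mulgA -qE mulgA -wclM mulg1 [RHS]rE -[m.+1]addn1 mkseqD.
  by rewrite /mkseq /= /wshift addn0.
move=> /(pmul_cancell huv) h; move: (h); rewrite (pmul_eq1 huv h) mul1g.
by move=> /(pmul_eq1 huv) /(wcl_eq1 huv).
Qed.

(** Divisibility of a prefix by [x] is decided on a prefix of bounded length:
    replacing twice, a multiple of [x] is rewritten as a word beginning with a
    short multiple of [x], and rigidity identifies that word with [z]. *)
Lemma Free_decide (x : M) : exists N, forall z, Free z ->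
  ev (chiw z) (Jid x) -> rideal x (cl (mkseq z N)).
Proof.
have [N hN] := Free_replace x; exists N => z fz /ev_chi_inf [n /ridealP [t zE]].
pose z1 := wshift n z.
have z1E j : x * (t * cl (mkseq z1 j)) = cl (mkseq z (n + j)).
  by rewrite mulgA -zE -wclM -mkseqD.
have [N1 h1N] := Free_replace t.
have [|j|h1 [i1 [_ h1E fz1]]] := h1N z1; first exact: Free_shift.
  by move=> /(w_two_sided x); rewrite z1E; exact: Free_w.
pose Y1 := wcat h1 (wshift i1 z1).
have Y1E y : (exists j, rideal y (x * cl (mkseq Y1 j))) <-> ev (chiw z) (Jid y).
  rewrite ev_chi_inf; split=> -[j hj].
    exists (n + (i1 + j))%N; rewrite -z1E mkseqD wclM !mulgA -(mulgA x) -h1E.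
    rewrite -mulgA -wclM -mkseq_wcat addnC mkseqD wclM mulgA.
    exact: rideal_mulr.
  exists (size h1 + j)%N; rewrite mkseq_wcat wclM h1E -mulgA -wclM -mkseqD z1E.
  by apply: rideal_mkseq hj; lia.
have [|j hj|h2 [i2 [h2N h2E fz2]]] := hN Y1; first exact: fz1.
  have /Y1E/ev_chi_inf [m] : exists j, rideal w (x * cl (mkseq Y1 j)) by exists
    j.
  exact: Free_w.
have zE2 : wcat h2 (wshift i2 Y1) = z.
  apply: Free_inj => //; apply: Omega_ext => y.
  by apply/idP/idP => [/(ev_chi_replace _ h2E)/Y1E|/Y1E/(ev_chi_replace _ h2E)].
have : rideal x (cl (mkseq z (size h2))).
  by rewrite -zE2 mkseq_wcat_take // take_size h2E; exact: ridealMr.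
exact: rideal_mkseq.
Qed.

End WordModel.

(** * Topologies given by a subbase *)

Section SubBase.
Variables (T : topologicalType) (B : set (set T)).
Hypothesis BE : @open T =
  [set \bigcup_(A in D) A | D in subset^~ (finI_from B id)].

Lemma subbase_open U : B U -> open U.
Proof.
move=> BU; rewrite BE; exists [set U]; last by rewrite bigcup_set1.
by move=> _ ->; exact: (@finI_from1 _ _ _ id).
Qed.

Lemma open_locally (U : set T) :
  (forall x, U x -> exists A, [/\ open A, A x & A `<=` U]) -> open U.
Proof.
move=> h; rewrite openE => x /h [A [Ao Ax AU]].
by apply: filterS AU _; exact: open_nbhs_nbhs.
Qed.

(** A neighbourhood property stable under finite intersections holds for all
    open sets as soon as it holds for the sets of a subbase. *)
Lemma subbase_ind (Q : nat -> T -> set T) (x : T) :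
  (forall m n, (m <= n)%N -> Q n x `<=` Q m x) ->
  (forall U, B U -> U x -> exists n, Q n x `<=` U) ->
  forall U, open U -> U x -> exists n, Q n x `<=` U.
Proof.
move=> Qmono QB U; rewrite BE => -[D DB <-] [V DV Vx].
have [K KB KV] := DB _ DV.
have hK A : A \in (K : seq (set T)) -> exists n, Q n x `<=` A.
  move=> AK; apply: QB; first exact: set_mem (KB A AK).
  by move: Vx; rewrite -KV => /(_ A AK).
have [n hn] : exists n, forall A, A \in (K : seq (set T)) -> Q n x `<=` A.
  elim: (K : seq (set T)) hK => [|A s ih] hs; first by exists 0%N.
  have [|n hn] := ih; first by move=> A' A's; apply: hs; rewrite inE A's orbT.
  have [m hm] := hs A (mem_head _ _).
  exists (maxn m n) => A'; rewrite inE => /predU1P[->|A's].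
    by apply: subset_trans hm; apply: Qmono; exact: leq_maxl.
  by apply: subset_trans (hn _ A's); apply: Qmono; exact: leq_maxr.
by exists n => y Qy; exists V => //; rewrite -KV => A KA; exact: hn.
Qed.

End SubBase.

(** * Block graphs and their infinite paths *)

Section FreeWords.
Variable F : seq (seq letter).
Implicit Types (z : nat -> letter) (x : seq letter).

Lemma isubwordE z i n : isubword z i n = mkseq (wshift i z) n.
Proof. by []. Qed.

Lemma infix_isubword x z i n : infix x (isubword z i n) ->
  exists j, isubword z (i + j) (size x) = x.
Proof.
move=> /infixP [p [s e]]; exists (size p).
have nE : n = (size p + (size x + size s))%N.
  by move: (congr1 size e); rewrite !size_cat size_mkseq.
move: e; rewrite isubwordE nE !mkseqD.
move=> /eqP; rewrite eqseq_cat ?size_mkseq // => /andP[_].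
rewrite eqseq_cat ?size_mkseq // => /andP[/eqP xE _].
by rewrite isubwordE -[RHS]xE wshiftD.
Qed.

Lemma free_inf_block z i n : free_inf F z -> free_word F (isubword z i n).
Proof.
move=> fz; apply/allP => x xF; apply/negP => /infix_isubword [j].
exact: fz.
Qed.

Lemma isubword_infix z i n : infix (isubword z i n) (mkseq z (i + n)).
Proof. by rewrite mkseqD; apply: infix_catl; exact: infix_refl. Qed.

Lemma free_infP z : free_inf F z <-> forall n, free_word F (mkseq z n).
Proof.
split=> [fz n|h x i xF e]; first exact: (free_inf_block 0 n).
have /allP /(_ _ xF) := h (i + size x)%N.
by rewrite -{1}e isubword_infix.
Qed.

Lemma free_inf_shift z n : free_inf F z -> free_inf F (wshift n z).
Proof.
move=> fz x i xF; rewrite isubwordE wshiftD.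
exact: fz.
Qed.

End FreeWords.

Section BlockGraph.
Variables (F : seq (seq letter)) (L : nat).
Hypotheses (L0 : (0 < L)%N) (LF : forall x, x \in F -> (size x <= L.+1)%N).
Local Notation E := (block_graph F L).
Local Notation lab := (@block_label F L).
Implicit Types (z : nat -> letter) (b : bdry E) (e : edge E).

Definition vword (x : vert E) : seq letter := val (val x).

Lemma vword_inj : injective vword.
Proof. by move=> x y /val_inj/val_inj. Qed.

Lemma size_vword x : size (vword x) = L.
Proof. exact: size_tuple. Qed.

Lemma edge_inj e e' : rg e = rg e' -> sc e = sc e' -> e = e'.
Proof.
move=> h1 h2; apply: val_inj.
by rewrite [val e]surjective_pairing [val e']surjective_pairing; congr pair.
Qed.

Lemma edge_word e : exists t, rcons (vword (rg e)) t = lab e :: vword (sc e) /\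
  free_word F (rcons (vword (rg e)) t).
Proof.
have /existsP [s /existsP [t /andP[/eqP h hf]]] := valP e.
exists t; split=> //; rewrite [LHS]h; congr cons.
rewrite /block_label; move: h (size_vword (rg e)); rewrite /vword /=.
by case: (tval _) => [_ L1|c y [->]//]; move: L0; rewrite -L1.
Qed.

Lemma vert_ex z i : free_inf F z -> exists x : vert E, vword x = isubword z i L.
Proof.
move=> fz; have sz : size (isubword z i L) == L by rewrite size_mkseq.
have h : `[< exists z' j, free_inf F z' /\ isubword z' j L = Tuple sz >].
  by apply/asboolP; exists z, i.
by exists (exist _ (Tuple sz) h).
Qed.

Lemma isubwordS z i n : isubword z i n.+1 = z i :: isubword z i.+1 n.
Proof.
rewrite isubwordE -add1n mkseqD wshiftD addn1.
by rewrite {1}/mkseq /= /wshift addn0.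
Qed.

Lemma isubwordSr z i n : isubword z i n.+1 = rcons (isubword z i n) (z (i +
  n)%N).
Proof. by rewrite /isubword /mkseq -addn1 iotaD map_cat /= cats1. Qed.

Lemma edge_ex z i (x y : vert E) : free_inf F z ->
  vword x = isubword z i L -> vword y = isubword z i.+1 L ->
  exists e, rg e = x /\ sc e = y.
Proof.
move=> fz xE yE.
have h : [exists s : letter, [exists t : letter,
     (rcons (val x) t == s :: val y) && free_word F (rcons (val x) t)]].
  apply/existsP; exists (z i); apply/existsP; exists (z (i + L)%N).
  rewrite -[tval (val x)]/(vword x) -[tval (val y)]/(vword y) xE yE.
  by rewrite -isubwordSr -isubwordS eqxx; exact: free_inf_block.
pose e : block_edge F L := exist _ (x, y) h.
by exists e.
Qed.

(** Every vertex receives finitely many edges, but at least one, since it is a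
    block of an infinite free word; so the boundary consists of infinite
    paths. *)
Lemma bdry_inr b : exists2 f, val b = inr f & forall i, sc (f i) = rg (f i.+1).
Proof.
have := valP b; case: (val b) => [mu|f] /asboolP //=; last by exists f.
move=> [_ [h|]]; last by case; exact: finite_finset.
exfalso; have /asboolP [z [i [fz xz]]] := valP (fsrc mu).
have [y yE] := vert_ex i.+1 fz.
have [|e [e1 _]] := @edge_ex z i (fsrc mu) y fz _ yE; first by rewrite xz.
by rewrite -[False]/(set0 e) -h.
Qed.

Definition bword b : nat -> letter :=
  if val b is inr f then fun i => lab (f i) else fun=> la.

Lemma bword_inr b f : val b = inr f -> bword b = fun i => lab (f i).
Proof. by rewrite /bword => ->. Qed.

(** Consecutive vertices overlap in all but one letter, so that letter [j] of
    one vertex is the first letter of the [j]-th vertex after it. *)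
Lemma vword_path (f : nat -> edge E) i : (forall i, sc (f i) = rg (f i.+1)) ->
  vword (rg (f i)) = isubword (fun i => lab (f i)) i L.
Proof.
move=> hf; apply: (@eq_from_nth _ la); rewrite ?size_vword ?size_mkseq // => j.
elim: j i => [|j ih] i jL; have [t [h _]] := edge_word (f i).
  by rewrite nth_mkseq // addn0 nth0.
have := ih i.+1 (ltnW jL); rewrite !nth_mkseq ?(ltnW jL) // addSnnS => <-.
rewrite -hf; have /(congr1 (nth la ^~ j.+1)) := h.
by rewrite nth_rcons size_vword jL.
Qed.

Lemma edge_path (f : nat -> edge E) i : (forall i, sc (f i) = rg (f i.+1)) ->
  free_word F (isubword (fun i => lab (f i)) i L.+1).
Proof.
move=> hf; have [t [h ]] := edge_word (f i).
by rewrite h hf vword_path // -(isubwordS (fun i => lab (f i))).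
Qed.

Lemma bword_free b : free_inf F (bword b).
Proof.
have [f bf hf] := bdry_inr b; rewrite (bword_inr bf) => x i xF e.
have /allP /(_ _ xF) /negP := edge_path i hf; apply.
have -> : L.+1 = (size x + (L.+1 - size x))%N by rewrite subnKC ?LF.
rewrite isubwordE mkseqD.
apply: infix_catr; rewrite -{1}e; exact: infix_refl.
Qed.

Lemma bword_surj z : free_inf F z -> exists b, bword b = z.
Proof.
move=> fz; have [x xE] := choice (fun i => vert_ex i fz).
have [f fE] := choice (fun i => edge_ex fz (xE i) (xE i.+1)).
have hf i : sc (f i) = rg (f i.+1) by rewrite (fE i).2 (fE i.+1).1.
have h : `[< is_boundary (inr f : rawpath E) >] by exact/asboolP.
exists (exist _ (inr f) h); apply/funext => i; rewrite /bword /=.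
have := xE i; rewrite -(fE i).1 (vword_path i hf) => /(congr1 (nth la ^~ 0%N)).
by rewrite !nth_mkseq // addn0.
Qed.

Lemma path_local (f f' : nat -> edge E) n :
  (forall i, sc (f i) = rg (f i.+1)) -> (forall i, sc (f' i) = rg (f' i.+1)) ->
  mkseq (fun i => lab (f i)) (n + L) = mkseq (fun i => lab (f' i)) (n + L) ->
  forall i, (i < n)%N -> f i = f' i.
Proof.
move=> hf hf' e i ilt.
have h j : (j <= n)%N -> rg (f j) = rg (f' j).
  move=> jn; apply: vword_inj; rewrite !vword_path //.
  apply: (@eq_from_nth _ la); rewrite !size_mkseq // => k kL.
  rewrite !nth_mkseq //; have /(congr1 (nth la ^~ (j + k)%N)) := e.
  by rewrite !nth_mkseq //; lia.
by apply: edge_inj; rewrite ?hf ?hf' h //; lia.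
Qed.

Lemma bword_inj : injective bword.
Proof.
move=> b b'; have [f bf hf] := bdry_inr b; have [f' bf' hf'] := bdry_inr b'.
rewrite (bword_inr bf) (bword_inr bf') => e; apply: val_inj; rewrite bf bf'.
congr inr; apply/funext => i.
by apply: (path_local hf hf' (n := i.+1)) => //; rewrite e.
Qed.

End BlockGraph.

(** * The boundary and the path groupoid *)

Section Boundary.
Variables (F : seq (seq letter)) (L : nat).
Hypothesis L0 : (0 < L)%N.
Local Notation E := (block_graph F L).
Local Notation lab := (@block_label F L).
Implicit Types (z : nat -> letter) (b zeta : bdry E) (mu lambda : Defs.fpath E).

Lemma walk_mkseq (f : nat -> edge E) n : (forall i, sc (f i) = rg (f i.+1)) ->
  walk (rg (f 0%N)) (mkseq f n) /\
  last (rg (f 0%N)) [seq sc e | e <- mkseq f n] = rg (f n).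
Proof.
elim: n f => [//|n ih] f hf.
have -> : mkseq f n.+1 = f 0%N :: mkseq (fun i => f i.+1) n.
  by rewrite /mkseq /= (iotaDl 1 0) -map_comp.
have [h1 h2] := ih (fun i => f i.+1) (fun i => hf i.+1).
by rewrite -hf in h1 h2; split; [rewrite /= eqxx|].
Qed.

Lemma bdry_split b n : exists mu zeta,
  [/\ is_fpath mu, fsrc mu = prng (val zeta), val b = pcat mu (val zeta)
    & flen mu = n].
Proof.
have [f bf hf] := bdry_inr b; have [h1 h2] := walk_mkseq n hf.
have h : `[< is_boundary (inr (fun i => f (n + i)%N) : rawpath E) >].
  by apply/asboolP => i; rewrite addnS.
exists (rg (f 0%N), mkseq f n), (exist _ (inr (fun i => f (n + i)%N)) h);
  split=> //.
- by rewrite /fsrc /= h2 addn0.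
- rewrite bf /=; congr inr; apply/funext => i; rewrite /flen /= size_mkseq.
  by case: ltnP => hi; [rewrite nth_mkseq|rewrite subnKC].
- by rewrite /flen size_mkseq.
Qed.

Lemma walk_nth x (es : seq (edge E)) e0 i : walk x es -> (i.+1 < size es)%N ->
  sc (nth e0 es i) = rg (nth e0 es i.+1).
Proof.
elim: es x i => // e es ih x [|i] /= /andP[_ wes]; last exact: ih wes.
by case: es wes {ih} => // e' es /= /andP[/eqP ->].
Qed.

Lemma bdry_pcat mu zeta : is_fpath mu -> fsrc mu = prng (val zeta) ->
  exists b, val b = pcat mu (val zeta).
Proof.
have [g zg hg] := bdry_inr zeta; rewrite zg => hmu hs.
have h : `[< is_boundary (pcat mu (inr g) : rawpath E) >].
  apply/asboolP => i; rewrite /flen.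
  case: (ltnP i) => hi; last by rewrite ltnNge (leqW hi) subSn //; exact: hg.
  case: ltnP => hi'; first exact: walk_nth hmu hi'.
  have -> : (i.+1 - size mu.2 = 0)%N by lia.
  rewrite -[rg (g 0%N)]hs (_ : i = (size mu.2).-1) ?nth_last; last by lia.
  rewrite /fsrc; case: mu.2 hi => // e es _; exact: (esym (last_map (@sc E) es
    e)).
by exists (exist _ (pcat mu (inr g)) h).
Qed.

Lemma bword_pcat b mu zeta : val b = pcat mu (val zeta) ->
  bword b = wcat (label lab mu) (bword zeta).
Proof.
have [g zg hg] := bdry_inr zeta; rewrite zg => /bword_inr ->.
rewrite (bword_inr zg); apply/funext => i; rewrite /wcat size_map /flen.
by case: ltnP => // hi; rewrite (nth_map (g 0%N)).
Qed.

Lemma label_pcat b mu zeta : val b = pcat mu (val zeta) ->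
  label lab mu = mkseq (bword b) (flen mu) /\
  bword zeta = wshift (flen mu) (bword b).
Proof.
move=> /bword_pcat ->.
have -> : flen mu = size (label lab mu) by rewrite size_map.
by rewrite mkseq_wcat_take // take_size wshift_wcat.
Qed.

(** Concatenation with an infinite path forgets the range of the finite one, so
    that only the edges and the source are compared. *)
Lemma cylinderP b f mu : val b = inr f -> (forall i, sc (f i) = rg (f i.+1)) ->
  cylinder mu b <-> fsrc mu = rg (f (flen mu)) /\ mu.2 = mkseq f (flen mu).
Proof.
move=> bf hf; split=> [[zeta rz]|[h1 h2]].
  have [g zg hg] := bdry_inr zeta; move: rz; rewrite bf zg /= => <- [->].
  rewrite ltnn subnn; split=> //.
  apply: (@eq_from_nth _ (g 0%N)) => [|i ilt]; rewrite ?size_mkseq //.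
  by rewrite nth_mkseq // ilt.
have h : `[< is_boundary (inr (fun i => f (flen mu + i)%N) : rawpath E) >].
  by apply/asboolP => i; rewrite addnS.
exists (exist _ (inr (fun i => f (flen mu + i)%N)) h);
  first by rewrite /= addn0.
rewrite bf /=; congr inr; apply/funext => i; rewrite h2.
by case: ltnP => hi; [rewrite nth_mkseq|rewrite subnKC].
Qed.

Lemma cylinder_local b b' mu :
  mkseq (bword b') ((flen mu).+1 + L) = mkseq (bword b) ((flen mu).+1 + L) ->
  cylinder mu b -> cylinder mu b'.
Proof.
have [f bf hf] := bdry_inr b; have [f' bf' hf'] := bdry_inr b'.
rewrite (bword_inr bf) (bword_inr bf') => /(path_local L0 hf' hf) e.
move=> /(cylinderP _ bf hf) [h1 h2]; apply/(cylinderP _ bf' hf').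
rewrite e //; split=> //; rewrite h2.
apply: (@eq_from_nth _ (f 0%N)) => [|i]; rewrite !size_mkseq // => ilt.
by rewrite !nth_mkseq // e // ltnW.
Qed.

Definition agree n b : set (bdry E) :=
  [set b' | mkseq (bword b') n = mkseq (bword b) n].

Lemma agree_mono b m n : (m <= n)%N -> agree n b `<=` agree m b.
Proof. by move=> mn b'; exact: eq_mkseq_le. Qed.

Lemma bdry_base_open (U : set (bdry E)) : bdry_base U -> open U.
Proof. exact: subbase_open. Qed.

Lemma agree_open n b : open (agree n b).
Proof.
apply: open_locally => b' bb'.
have [mu [zeta [hmu hz hb hn]]] := bdry_split b' n.
exists (cylinder mu); split.
- apply: bdry_base_open; exists mu, [::]; split=> //.
  by rewrite (_ : \bigcup_(e in _) _ = set0) ?setD0 // -subset0 => ? [].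
- by exists zeta.
- move=> b'' [zeta' _ h]; rewrite /agree /= -bb' -hn.
  by have [<- _] := label_pcat h; have [<- _] := label_pcat hb.
Qed.

(** Two paths whose words agree up to [n + L] have the same first [n] edges;
    hence the cylinders over [mu] and over its extensions by one edge are
      decided
    by a prefix of the word. *)
Lemma agree_nbhs (U : set (bdry E)) b : open U -> U b ->
  exists n, agree n b `<=` U.
Proof.
apply: (@subbase_ind _ (@bdry_base E) erefl agree b); first by move=> *;
  exact: agree_mono.
move=> _ [mu [S [hmu hS ->]]] [bmu bS].
exists ((flen mu).+2 + L)%N => b' bb'; split.
  by apply: cylinder_local bmu; apply: agree_mono bb'; lia.
move=> [e eS eb']; apply: bS; exists e => //.
by apply: cylinder_local eb'; rewrite /flen size_rcons.
Qed.

Lemma graph_arrow_base_open (U : set (graph_arrow E)) : graph_arrow_base U ->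
  open U.
Proof. exact: subbase_open. Qed.

Lemma tripleP (t : bdry E * int * bdry E) lambda mu zeta :
  is_triple t lambda mu zeta ->
  [/\ label lab lambda = mkseq (bword t.1.1) (flen lambda),
      label lab mu = mkseq (bword t.2) (flen mu),
      bword zeta = wshift (flen lambda) (bword t.1.1)
    & bword zeta = wshift (flen mu) (bword t.2)].
Proof. by move=> [_ _ /label_pcat[] ? ? _ /label_pcat[]]. Qed.

Lemma triple_ex b1 b2 l m : wshift l (bword b1) = wshift m (bword b2) ->
  exists (t : graph_arrow E) lambda mu zeta,
    [/\ val t = (b1, (l%:Z - m%:Z)%R, b2), flen lambda = l, flen mu = m
      & is_triple (val t) lambda mu zeta].
Proof.
have [lambda [zeta [hl hz hb ln]]] := bdry_split b1 l.
have [mu [zeta' [hm hz' hb' mn]]] := bdry_split b2 m.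
have [_ e] := label_pcat hb; have [_ e'] := label_pcat hb'.
rewrite -ln -mn -{}e -{}e' => /(bword_inj L0) zE; subst zeta'.
pose t : bdry E * int * bdry E := (b1, ((flen lambda)%:Z - (flen mu)%:Z)%R, b2).
have h : is_triple t lambda mu zeta by [].
have ht : `[< exists lambda mu zeta, is_triple t lambda mu zeta >].
  by apply/asboolP; exists lambda, mu, zeta.
by exists (exist _ t ht), lambda, mu, zeta.
Qed.

End Boundary.

(** * Topology of the groupoid of the partial action *)

Section OmegaTopology.
Variable M : monoidType.

Lemma ev_open (S : J M) (c : bool) : open [set chi : Omega M | ev chi S = c].
Proof.
have h : continuous (fun chi : Omega M => (val chi : {ptws J M -> bool}) S).
  move=> chi; apply: (@continuous_comp (Omega M) {ptws J M ->
    bool} bool set_val (fun f => f S)).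
    exact: initial_continuous.
  exact: (@proj_continuous _ (fun=> bool) S).
have /continuousP /(_ [set c]) := h; apply; exact: discrete_open.
Qed.

Lemma locally_constant_continuous (T U : topologicalType) (f : T -> U) :
  (forall t, exists A, [/\ open A, A t & forall t', A t' -> f t' = f t]) ->
  continuous f.
Proof.
move=> h t B /nbhs_singleton Bt; have [A [Ao At Af]] := h t.
have : nbhs t A by exact: open_nbhs_nbhs.
by apply: filterS => t' /Af /= ->.
Qed.

Lemma continuous_Omega (T : topologicalType) (f : T -> Omega M) :
  (forall S t, exists A, [/\ open A, A t & forall t', A t' ->
    ev (f t') S = ev (f t) S]) ->
  continuous f.
Proof.
move=> h; apply/continuousP => _ [B Bo <-]; rewrite comp_preimage.
move: B Bo; apply/continuousP => t.
apply/cvg_sup => S B [_ [[C Co <-] Ct CB]].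
have [A [Ao At Af]] := h S t.
have : nbhs t A by exact: open_nbhs_nbhs.
apply: filterS => t' /Af e; apply: CB => /=.
by move: Ct; rewrite /= -[_ S]/(ev (f t) S) -e.
Qed.

End OmegaTopology.

Section PactTopology.
Variables (M : monoidType) (Gr : groupType) (iota : M -> Gr) (Z :
  set (Omega M)).
Local Notation arrows := (pact_arrow iota Z).

Lemma pact_open (g : Gr) (S : J M) (c : bool) :
  open [set a : arrows | (val a).1 = g /\ ev (val a).2 S = c].
Proof.
exists ([set g] `*` [set chi | ev chi S = c]); last by apply/seteqP;
  split=> a [].
rewrite openE => -[g' chi] [/= -> hchi].
exists ([set g], [set chi | ev chi S = c]) => //; split.
  exact: discrete_set1.
by apply: open_nbhs_nbhs; split=> //; exact: ev_open.
Qed.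

Lemma continuous_pact (T : topologicalType) (f : T -> arrows) :
  (forall S t, exists A, [/\ open A, A t &
     forall t', A t' -> (val (f t')).1 = (val (f t)).1 /\
       ev (val (f t')).2 S = ev (val (f t)).2 S]) ->
  continuous f.
Proof.
move=> h.
have h1 : continuous (fun t => (val (f t)).1 : discrete_topology Gr).
  apply: locally_constant_continuous => t.
  by have [A [Ao At Af]] := h (J0 M) t; exists A; split=> // t' /Af [].
have h2 : continuous (fun t => (val (f t)).2).
  apply: continuous_Omega => S t.
  by have [A [Ao At Af]] := h S t; exists A; split=> // t' /Af [].
have h12 : continuous (fun t => ((val (f t)).1 : discrete_topology Gr,
  (val (f t)).2)).
  by move=> t; exact: (cvg_pair (h1 t) (h2 t)).
apply/continuousP => _ [B Bo <-].
have /continuousP /(_ _ Bo) := h12; congr open.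
by apply/seteqP; split=> t /=; rewrite -surjective_pairing.
Qed.

End PactTopology.

(** * A criterion for graph models *)

Section GraphModelCriterion.
Variables u v : seq letter.
Hypothesis huv : standing_assumptions u v.
Hypothesis hlcm : right_LCM (P u v).
Hypothesis hrev : left_reversible (P u v).
Local Notation M := (P u v).
Local Notation iota := (@toG u v).
Local Notation cl := (eltP u v).
Local Notation chiw := (chi_inf (onerel u v)).

Variables (F : seq (seq letter)) (L : nat).
Hypotheses (L0 : (0 < L)%N) (LF : forall x, x \in F -> (size x <= L.+1)%N).
Local Notation E := (block_graph F L).
Local Notation lab := (@block_label F L).

Variable w : M.
Hypothesis w_two_sided : forall p x, rideal w x -> rideal w (p * x).
Hypothesis F_w : forall z n, free_inf F z -> ~ rideal w (cl (mkseq z n)).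
Hypothesis F_rigid : exists k, forall z z' n, free_inf F z -> free_inf F z' ->
  ev (chiw z') (Jid (cl (mkseq z (n + k)))) -> mkseq z' n = mkseq z n.
Hypothesis F_replace : forall x : M, exists N, forall z, free_inf F z ->
  (forall n, ~ rideal w (x * cl (mkseq z n))) ->
  exists h i, [/\ (size h <= N)%N, cl h = x * cl (mkseq z i)
                & free_inf F (wcat h (wshift i z))].
Hypothesis F_Yset : forall chi, Yset w chi ->
  exists2 z, free_inf F z & chi = chiw z.

Local Notation graph_arr := (graph_arrow E).
Local Notation pact_arr := (pact_arrow iota (Yset w)).
Implicit Types (t : graph_arr) (z : nat -> letter) (b : bdry E).

Lemma phi_bword b : @phi u v E lab b = chiw (bword b).
Proof. by have [f bf _] := bdry_inr b; rewrite /phi (bword_inr bf) bf. Qed.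

Lemma chiw_bword_inj b b' : chiw (bword b) = chiw (bword b') -> b = b'.
Proof.
move=> h; apply: (bword_inj L0).
by apply: (Free_inj F_rigid) h; exact: bword_free.
Qed.

(** The image in the group of an arrow from the path of word [z'] to the path of
    word [z], when the tails after [l] and [m] letters agree. *)
Definition gval z l z' m : G u v := iota (cl (mkseq z l)) * (iota (cl (mkseq z'
  m)))^-1.

Lemma gvalD z z' l m d : wshift l z = wshift m z' ->
  gval z (l + d) z' (m + d) = gval z l z' m.
Proof. by move=> h; rewrite /gval !mkseqD h !wclM !toGM mulgKA. Qed.

Lemma wshift_add z z' l m d : wshift l z = wshift m z' ->
  wshift (l + d) z = wshift (m + d) z'.
Proof. by move=> h; rewrite -!wshiftD h. Qed.

Lemma gval_eq z z' l m l' m' :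
  wshift l z = wshift m z' -> wshift l' z = wshift m' z' ->
  (l + m' = l' + m)%N -> gval z l z' m = gval z l' z' m'.
Proof.
wlog : l m l' m' / (l <= l')%N => [h|ll h h' e].
  case: (leqP l l') => [|/ltnW] ll h1 h2 e; first exact: h.
  by symmetry; apply: h; rewrite // e.
have lE : l' = (l + (l' - l))%N by lia.
have mE : m' = (m + (l' - l))%N by lia.
by rewrite lE mE gvalD.
Qed.

Lemma cl_mkseq_inj z : injective (fun n => cl (mkseq z n)).
Proof.
move=> i j; wlog : i j / (i <= j)%N => [h e|ij].
  by case: (leqP i j) => [|/ltnW] ij; [|symmetry]; exact: h.
rewrite -(subnKC ij) mkseqD wclM -[LHS]mulg1 => /(pmul_cancell huv)/esym.
move=> /(wcl_eq1 huv) /(congr1 size); rewrite size_mkseq /= => ->.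
by rewrite addn0.
Qed.

(** Two different lags with the same group element would give two prefixes of
    [z] of different lengths with the same class, which cancellation forbids. *)
Lemma gval_inj z z' l m l' m' :
  wshift l z = wshift m z' -> wshift l' z = wshift m' z' ->
  gval z l z' m = gval z l' z' m' -> (l + m' = l' + m)%N.
Proof.
wlog : l m l' m' / (m <= m')%N => [h|mm h h' e].
  case: (leqP m m') => [|/ltnW] mm h1 h2 e; first exact: h.
  by symmetry; apply: h.
have mE : m' = (m + (m' - m))%N by lia.
move: e; rewrite -(gvalD (m' - m) h) -mE => /mulIg /(toG_inj huv hrev).
by move=> /cl_mkseq_inj; lia.
Qed.

Lemma is_pact_bword b b' l m :
  wshift l (bword b) = wshift m (bword b') ->
  is_pact iota (gval (bword b) l (bword b') m) (chiw (bword b')) (chiw (bword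
    b)).
Proof.
move=> h; have := is_pact_shift huv hrev (mkseq (bword b) l) (mkseq (bword b')
  m)
  (wshift m (bword b')).
by rewrite wcat_mkseq -h wcat_mkseq.
Qed.

Definition xw t := bword (val t).1.1.
Definition yw t := bword (val t).2.

(** [l] and [m] are lengths of finite paths that present the arrow; they are
    determined up to a common increment. *)
Definition lag t l m := wshift l (xw t) = wshift m (yw t) /\
  (val t).1.2 = (l%:Z - m%:Z)%R.

Lemma lag_ex t : exists l m, lag t l m.
Proof.
have /asboolP [lambda [mu [zeta h]]] := valP t.
exists (flen lambda), (flen mu); split; last by have [] := h.
by have [_ _ <- <-] := tripleP h.
Qed.

Lemma arrow_ex b b' l m : wshift l (bword b) = wshift m (bword b') ->
  exists t, val t = (b, (l%:Z - m%:Z)%R, b').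
Proof. by move=> /(triple_ex L0) [t [_ [_ [_ [tE _ _ _]]]]]; exists t. Qed.

Lemma Yset_bword b : Yset w (chiw (bword b)).
Proof. by apply: (Free_Yset huv F_w); exact: bword_free. Qed.

Lemma Phi_ex : exists Phi : graph_arr -> pact_arr, forall t l m, lag t l m ->
  val (Phi t) = (gval (xw t) l (yw t) m, chiw (yw t)).
Proof.
suff h t : exists a : pact_arr, forall l m, lag t l m ->
    val a = (gval (xw t) l (yw t) m, chiw (yw t)).
  by have [f fP] := choice h; exists f.
have [l [m [h tE]]] := lag_ex t.
have hp := is_pact_bword h.
have ha : pact_arrows iota (Yset w) (gval (xw t) l (yw t) m, chiw (yw t)).
  split=> /=.
  - by have [p [q [gE qchi _ _]]] := hp; exists p, q.
  - exact: Yset_bword.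
  - by rewrite (pactE huv hlcm hrev hp); exact: Yset_bword.
exists (exist _ (gval (xw t) l (yw t) m, chiw (yw t)) (mem_set ha)) =>
  l' m' [h' tE'] /=.
by congr pair; apply: gval_eq => //; lia.
Qed.

Section Phi.
Variable Phi : graph_arr -> pact_arr.
Hypothesis PhiE : forall t l m, lag t l m ->
  val (Phi t) = (gval (xw t) l (yw t) m, chiw (yw t)).

Lemma Phi2 t : (val (Phi t)).2 = chiw (yw t).
Proof. by have [l [m /PhiE ->]] := lag_ex t. Qed.

Lemma pact_Phi t : pact iota (val (Phi t)).1 (val (Phi t)).2 = chiw (xw t).
Proof.
have [l [m tlm]] := lag_ex t; rewrite (PhiE tlm).
by apply: (pactE huv hlcm hrev); apply: is_pact_bword; have [] := tlm.
Qed.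

Lemma arrow_eq t t' : (val t).1.1 = (val t').1.1 ->
  (val t).1.2 = (val t').1.2 ->
  (val t).2 = (val t').2 -> t = t'.
Proof.
move=> h1 h2 h3; apply: val_inj.
by case: (val t) (val t') h1 h2 h3 => [[? ?] ?] [[? ?] ?] /= -> -> ->.
Qed.

Lemma Phi_inj : injective Phi.
Proof.
move=> t t' e.
have e2 : (val t).2 = (val t').2.
  by apply: chiw_bword_inj; rewrite -!/(yw _) -!Phi2 e.
have e1 : (val t).1.1 = (val t').1.1.
  by apply: chiw_bword_inj; rewrite -!/(xw _) -!pact_Phi e.
have [l [m tlm]] := lag_ex t; have [l' [m' tlm']] := lag_ex t'.
apply: arrow_eq => //; rewrite tlm.2 tlm'.2.
have := PhiE tlm; rewrite e (PhiE tlm') /xw /yw e1 e2 => -[/esym].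
have [h _] := tlm; have [h' _] := tlm'; rewrite /xw /yw e1 e2 in h.
by move=> /(gval_inj h h'); lia.
Qed.

(** If [g = p q^-1] acts on [chi_z] then [q] divides a prefix of [z], so [g] has
    a prefix of [z] as a denominator and [g.chi_z] is the character of [p']
      times
    a tail of [z]; replacement turns the latter into a free word with the same
    tail. *)
Lemma Phi_surj (a : pact_arr) : exists t, Phi t = a.
Proof.
have [[p [q [gE qchi]]] Y1 Y2] := set_mem (valP a).
case: a gE qchi Y1 Y2 => -[g chi] /= ha gE qchi Y1 Y2.
have [z fz chiE] := F_Yset Y1; subst chi.
have /ev_chi_inf [m /ridealP [r mE]] := qchi.
have [s sE] := wcl_surj (p * r).
have gE' : g = iota (cl s) * (iota (cl (mkseq z m)))^-1.
  by rewrite -sE mE !toGM mulgKA.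
have hp := is_pact_shift huv hrev s (mkseq z m) (wshift m z).
rewrite wcat_mkseq -gE' in hp.
rewrite (pactE huv hlcm hrev hp) in Y2.
have [N hN] := F_replace (cl s).
have [||h [i [_ hE fX]]] := hN (wshift m z); first exact: free_inf_shift.
  move=> n hw; have [_ /negP] := Y2; apply; apply/ev_chi_inf_cat.
  by exists n.
rewrite wshiftD in fX; set X := wcat h _ in fX.
have [b bX] := bword_surj L0 fX; have [b' b'z] := bword_surj L0 fz.
have e : wshift (size h) (bword b) = wshift (m + i) (bword b').
  by rewrite bX b'z wshift_wcat.
have [t tE] := arrow_ex e.
exists t; apply: val_inj => /=.
rewrite (PhiE (l := size h) (m := m + i)); last by rewrite /lag /xw /yw tE.
rewrite /xw /yw tE /= bX b'z; congr pair.
rewrite /gval gE' mkseq_wcat_take // take_size hE mkseqD wclM !toGM.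
by rewrite mulgKA.
Qed.

Lemma lagD t l m d : lag t l m -> lag t (l + d) (m + d).
Proof. by move=> [h tE]; split; [exact: wshift_add|lia]. Qed.

Lemma Phi_mul t1 t2 t3 : @gmul (graph_groupoid E) t1 t2 t3 ->
  (val (Phi t3)) = (((val (Phi t1)).1 : G u v) * (val (Phi t2)).1,
    (val (Phi t2)).2).
Proof.
move=> [e12 e3]; have [l [m h1]] := lag_ex t1; have [l' [m' h2]] := lag_ex t2.
have h3 : lag t3 (l + l') (m' + m).
  have [e1 n1] := lagD l' h1; have [e2 n2] := lagD m h2.
  split; last by rewrite e3 /= n1 n2; lia.
  by rewrite /xw /yw e3 e1 /yw e12 -/(xw t2) addnC e2.
rewrite (PhiE h3) (PhiE (lagD l' h1)) (PhiE (lagD m h2)) /=.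
rewrite /xw /yw e3 e12 /=; congr pair.
by rewrite /gval (addnC m l') mulgA mulgVK.
Qed.

Lemma gmul_ex t1 t2 : (val t1).2 = (val t2).1.1 ->
  exists t3, @gmul (graph_groupoid E) t1 t2 t3.
Proof.
move=> e12; have [l [m h1]] := lag_ex t1; have [l' [m' h2]] := lag_ex t2.
have [e1 n1] := lagD l' h1; have [e2 n2] := lagD m h2.
have [|t3 t3E] := @arrow_ex (val t1).1.1 (val t2).2 (l + l') (m' + m).
  by rewrite -/(xw t1) e1 /yw e12 -/(xw t2) addnC e2.
exists t3; split=> //; rewrite t3E n1 n2; congr (_, _, _); lia.
Qed.

Lemma Phi_gmul t1 t2 t3 : @gmul (graph_groupoid E) t1 t2 t3 <->
  @gmul (pact_groupoid iota (Yset w)) (Phi t1) (Phi t2) (Phi t3).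
Proof.
split=> [h|[e1 e2]].
  split; last exact: Phi_mul.
  by rewrite pact_Phi Phi2 /yw; case: h => ->.
have [|t h] := @gmul_ex t1 t2.
  by apply: chiw_bword_inj; rewrite -/(yw t1) -Phi2 e1 pact_Phi.
suff -> : t3 = t by [].
by apply: Phi_inj; apply: val_inj; rewrite (Phi_mul h).
Qed.

Lemma lag_inv t t' : @ginverse (graph_groupoid E) t t' -> forall l m,
  lag t l m -> lag t' m l.
Proof.
move=> e l m [h n]; split; first by rewrite /xw /yw e.
by rewrite e /= n; lia.
Qed.

Lemma Phi_ginverse t t' : @ginverse (graph_groupoid E) t t' <->
  @ginverse (pact_groupoid iota (Yset w)) (Phi t) (Phi t').
Proof.
have hfwd t1 t2 : @ginverse (graph_groupoid E) t1 t2 ->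
    val (Phi t2) = (((val (Phi t1)).1 : G u v)^-1,
      pact iota (val (Phi t1)).1 (val (Phi t1)).2).
  move=> e; have [l [m h]] := lag_ex t1.
  rewrite pact_Phi (PhiE h) (PhiE (lag_inv e h)) /xw /yw e /=.
  by rewrite /gval invgF.
split=> [/hfwd//|e].
have [l [m [h n]]] := lag_ex t; have [t1 t1E] := arrow_ex (esym h).
have e1 : @ginverse (graph_groupoid E) t t1.
  by rewrite /ginverse /= t1E n; congr (_, _, _); lia.
suff -> : t' = t1 by [].
by apply: Phi_inj; apply: val_inj; rewrite (hfwd _ _ e1).
Qed.

Lemma triple_Phi t lambda mu zeta : is_triple (val t) lambda mu zeta ->
  val (Phi t) = (iota (cl (label lab lambda)) * (iota (cl (label lab mu)))^-1,
                 chiw (yw t)).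
Proof.
move=> ht; have [h1 h2 h3 h4] := tripleP ht.
rewrite (PhiE (l := flen lambda) (m := flen mu)); last first.
  by split; [rewrite /xw -h3|have [] := ht].
by rewrite /gval h1 h2.
Qed.

Lemma Phi_continuous : continuous Phi.
Proof.
apply: continuous_pact => S t.
have /asboolP [lambda [mu [zeta ht]]] := valP t.
have [N hN] : exists N, forall b, agree N (val t).2 b ->
    ev (chiw (bword b)) S = ev (chiw (yw t)) S.
  have [SE|[x SE]] := set_mem (valP S).
    have -> : S = J0 M by exact: val_inj.
    exists 0%N => b _; have [_ + _] := set_mem (valP (chiw (bword b))).
    have [_ + _] := set_mem (valP (chiw (yw t))).
    by rewrite /ev => -> ->.
  have -> : S = Jid x by exact: val_inj.
  have [N hN] := Free_decide w_two_sided (@free_inf_shift F) F_w F_rigid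
    F_replace x.
  exists N => b bb; apply/idP/idP => h.
    by apply/ev_chi_inf; exists N; rewrite -bb; apply: hN => //;
      exact: bword_free.
  by apply/ev_chi_inf; exists N; rewrite bb; apply: hN => //; exact: bword_free.
exists [set t' | exists2 zeta', agree N zeta zeta' & is_triple (val t') lambda
  mu zeta'].
split.
- apply: graph_arrow_base_open; exists lambda, mu, (agree N zeta); split=> //.
  + by have [] := ht.
  + by have [_ [-> ->]] := ht.
  + exact: agree_open.
- by exists zeta.
move=> t' [zeta' zz ht'].
have [h1 h2 h3 h4] := tripleP ht; have [h1' h2' h3' h4'] := tripleP ht'.
rewrite (triple_Phi ht) (triple_Phi ht'); split=> //.
rewrite /= hN // /agree /=; apply: (@eq_mkseq_le _ _ _ (flen mu + N)).
  exact: leq_addl.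
by rewrite !mkseqD -h4 -h4' -h2 -h2' zz.
Qed.

(** Neighbourhoods of an arrow can be described by its image: an arrow with the
    same group element whose source word has a long common prefix with that of
    [t] has the same presenting paths as [t], because [Phi] is injective. *)
Lemma agree_arrow (U : set graph_arr) t : open U -> U t ->
  exists n, [set t' | (val (Phi t')).1 = (val (Phi t)).1 /\
                      agree n (val t).2 (val t').2] `<=` U.
Proof.
pose Q n t := [set t' | (val (Phi t')).1 = (val (Phi t)).1 /\
                      agree n (val t).2 (val t').2].
apply: (@subbase_ind _ (@graph_arrow_base E) erefl Q t).
  by move=> m n mn t' [h1 h2]; split=> //; apply: agree_mono h2.
move=> _ [lambda [mu [V [[hl hm] hlm Vo ->]]]] [zeta Vz ht].
have [k hk] := agree_nbhs L0 Vo Vz.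
have [h1 h2 h3 h4] := tripleP ht.
(* The first [(flen mu).+1 + L] letters force the source of [t'] to begin with
   [mu], and [k] more put the remaining path in [V]. *)
exists ((flen mu).+1 + L + k)%N => t' [e ty].
have [zeta' hz' ht'] : cylinder mu (val t').2.
  apply: (cylinder_local L0 (b := (val t).2)).
    by apply: agree_mono ty; lia.
  by have [_ [_ hmu] _ _ ht2] := ht; exists zeta.
have [l' z'E] := label_pcat ht'.
have Vz' : V zeta'.
  apply: hk; rewrite /agree /= z'E h4.
  have /(congr1 (drop (flen mu))) : mkseq (bword (val t').2) (flen mu + k) =
      mkseq (bword (val t).2) (flen mu + k) by apply: agree_mono ty; lia.
  by rewrite !mkseqD !drop_size_cat ?size_mkseq.
have [b bE] : exists b, val b = pcat lambda (val zeta').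
  by apply: bdry_pcat => //; rewrite hz'.
(* This arrow has the source and the group element of [t']. *)
pose r : bdry E * int * bdry E :=
  (b, ((flen lambda)%:Z - (flen mu)%:Z)%R, (val t').2).
have hr : is_triple r lambda mu zeta' by split=> //; rewrite hlm hz'.
have hr' : `[< exists lambda mu zeta, is_triple r lambda mu zeta >].
  by apply/asboolP; exists lambda, mu, zeta'.
pose t'' : graph_arr := exist _ r hr'.
suff -> : t' = t'' by exists zeta'.
apply: Phi_inj; apply: val_inj.
rewrite (@triple_Phi t'' _ _ _ hr) [LHS]surjective_pairing e (triple_Phi ht) /=.
by rewrite Phi2.
Qed.

(** By rigidity, agreement of source words up to [n] follows from the value of
    the character at a single prefix. *)
Lemma Phi_open (U : set graph_arr) : open U -> open (Phi @` U).
Proof.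
move=> Uo; apply: open_locally => _ [t Ut <-].
have [n hn] := agree_arrow Uo Ut; have [k hk] := F_rigid.
exists [set a : pact_arr | (val a).1 = (val (Phi t)).1 /\
  ev (val a).2 (Jid (cl (mkseq (yw t) (n + k)))) = true]; split.
- exact: pact_open.
- split=> //; rewrite Phi2; apply/ev_chi_inf; exists (n + k)%N.
  exact: rideal_refl.
move=> a; have [t' <-] := Phi_surj a; move=> [e1 e2].
exists t' => //; apply: hn; split=> //.
apply: hk; try exact: bword_free.
by rewrite -Phi2.
Qed.

End Phi.

Lemma graph_model_criterion : @graph_model u v E lab (Yset w).
Proof.
have [Phi PhiE] := Phi_ex; exists Phi; split.
  move=> t lambda mu zeta ht; rewrite (triple_Phi PhiE ht); congr pair.
  by rewrite phi_bword.
split.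
- have [g gK] := choice (Phi_surj PhiE).
  exists g => // t; apply: (Phi_inj PhiE); exact: gK.
- exact: Phi_continuous.
- exact: Phi_open.
- exact: Phi_gmul.
- exact: Phi_ginverse.
Qed.

End GraphModelCriterion.

(** * The ideal of [w] *)

Section TwoSided.
Variables u v : seq letter.
Local Notation M := (P u v).

(** The two factorisations of [w] say that [a w = w x'] and [b w = w y']. *)
Lemma rideal_two_sided (w x x' y y' : M) :
  w = eltP u v [:: la] * x -> w = x * x' -> w = eltP u v [:: lb] * y ->
    w = y * y' ->
  forall p q : M, rideal w q -> rideal w (p * q).
Proof.
move=> wa wx wb wy p q [r _ <-]; rewrite mulgA; apply: rideal_mulr.
have [s ->] := wcl_surj p; elim: s => [|c s ih].
  by rewrite (_ : eltP u v [::] = 1) // mul1g; exact: rideal_refl.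
rewrite -cat1s wclM -mulgA; case: ih => r' _ <-; rewrite mulgA.
apply: rideal_mulr; case: c.
  by exists x' => //; rewrite {2}wx mulgA -wa.
by exists y' => //; rewrite {2}wy mulgA -wb.
Qed.

Lemma ev_one (chi : Omega M) : ev chi (Jid 1) = true.
Proof.
have [/(_ true) [S hS] h0 _] := set_mem (valP chi).
have [SE|[x SE]] := set_mem (valP S).
  by move: hS; rewrite (_ : S = J0 M) ?h0 //; exact: val_inj.
apply: (@ev_mono _ _ _ _ x); first by exists x => //; rewrite mul1g.
by rewrite -(_ : S = Jid x) //; exact: val_inj.
Qed.

End TwoSided.

(** * Words avoiding both sides of the relation *)

Section RelatorIdeal.
Variables u v : seq letter.
Hypothesis huv : standing_assumptions u v.
Hypothesis hlcm : right_LCM (P u v).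
Hypothesis hrev : left_reversible (P u v).
Local Notation M := (P u v).
Local Notation cl := (eltP u v).
Local Notation chiw := (chi_inf (onerel u v)).
Local Notation F := [:: u; v].

Variable w : M.
Hypothesis w_two_sided : forall p x : M, rideal w x -> rideal w (p * x).
Hypothesis wu : w = cl u.

(** No relation applies to a word that contains neither side. *)
Lemma free_word_unique s t : free_word F s -> cl s = cl t -> s = t.
Proof.
move=> /and3P [su sv _] /wclP/cong_chain [n h].
case: h su sv => // k p x y q t' [[-> _]|[-> _]] _.
  by move=> /negP []; apply/infixP; exists p, q.
by move=> _ /negP []; apply/infixP; exists p, q.
Qed.

Lemma free_wordE s : free_word F s <-> ~ rideal w (cl s).
Proof.
split=> [sfree [q _ /esym]|hw].
  have [t ->] := wcl_surj q; rewrite wu -wclM => /(free_word_unique sfree) sE.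
  by move: sfree => /andP [/negP]; rewrite sE; apply: contra_not => _;
    apply/infixP; exists [::], t.
rewrite /free_word /= andbT; apply/andP; split;
  apply/negP => /infixP [p [q sE]];
  apply: hw; rewrite sE !wclM -?eltP_uv -wu; apply: w_two_sided;
    exact: ridealMr.
Qed.

Lemma free_infE z : free_inf F z <-> forall n, ~ rideal w (cl (mkseq z n)).
Proof.
by rewrite free_infP; split=> h n; apply/free_wordE.
Qed.

(** An element outside [w P] is a single word and its left divisors are the
    prefixes, so that rigidity holds with [k = 0] and a product with classes of
    prefixes outside [w P] is free as it stands. *)
Lemma relator_graph_model (L : nat) : (0 < L)%N ->
  (forall x, x \in F -> (size x <= L.+1)%N) ->
  @graph_model u v (block_graph F L) (@block_label F L) (Yset w).
Proof.
move=> L0 LF; apply: graph_model_criterion => //.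
- by move=> z n /free_infE.
- exists 0%N => z z' n fz fz'; rewrite addn0 => /ev_chi_inf [m zm].
  have /ridealP [q] : rideal (cl (mkseq z n)) (cl (mkseq z' (n + m))).
    by apply: rideal_mkseq zm; exact: leq_addl.
  have [t ->] := wcl_surj q; rewrite -wclM => /free_word_unique e.
  have /(congr1 (take n)) := e (free_inf_block 0 (n + m) fz').
  by rewrite mkseqD !take_size_cat ?size_mkseq.
- move=> x; have [s ->] := wcl_surj x; exists (size s) => z fz hw.
  exists s, 0%N; split=> //; first by rewrite -[RHS]wclM cats0.
  apply/free_infE => n hn; apply: (hw n); rewrite -wclM -(mkseq_wcat s z).
  by apply: rideal_mkseq hn; exact: leq_addl.
- move=> chi [chiinf chiw0].
  have [||c p Qc pchi|z [chiE _]] := @chi_inf_of_chain _ _ hlcm hrev chi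
    [set c | ev chi (Jid (cl c))] [::] chiinf.
  + exact: ev_one.
  + by [].
  + have [r [_ [q _ cr] pr rchi]] := ev_lcm hlcm hrev Qc pchi.
    have [e eE] := wcl_surj q; exists e; rewrite /= wclM -eE cr.
    by split.
  exists z => //; apply/free_infE => n hn.
  by move/negP: chiw0; apply; rewrite chiE; apply/ev_chi_inf; exists n.
Qed.

End RelatorIdeal.

(** * Words avoiding one side of a relation without overlaps *)

Section Avoiding.
Variable v : seq letter.
Implicit Types s t p q : seq letter.

Definition avoids s := ~~ infix v s.
Local Notation vfree := avoids.

Lemma vfree_sub p s q : vfree (p ++ s ++ q) -> vfree s.
Proof.
apply: contra => /infixP [p' [q' ->]]; apply/infixP.
by exists (p ++ p'), (q' ++ q); rewrite -!catA.
Qed.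

Lemma vfree_catl s t : vfree (s ++ t) -> vfree s.
Proof. exact: (@vfree_sub [::]). Qed.

Lemma vfree_catr s t : vfree (s ++ t) -> vfree t.
Proof. by have := @vfree_sub s t [::]; rewrite cats0. Qed.

Lemma vfree_mkseq_le (z : nat -> letter) m n : (m <= n)%N ->
  vfree (mkseq z n) -> vfree (mkseq z m).
Proof. by move=> /subnKC <-; rewrite mkseqD; exact: vfree_catl. Qed.

Lemma cat_split p q s t : p ++ q = s ++ t -> (size p <= size s)%N ->
  exists2 r, s = p ++ r & q = r ++ t.
Proof.
move=> + ps; rewrite -{1}(cat_take_drop (size p) s) -catA => /eqP.
rewrite eqseq_cat ?size_takel // => /andP[/eqP pE /eqP qE].
by exists (drop (size p) s) => //; rewrite {1}pE cat_take_drop.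
Qed.

Lemma straddle s t : vfree s -> vfree t -> ~~ vfree (s ++ t) ->
  exists p v1 v2 q, [/\ s = p ++ v1, v = v1 ++ v2 & t = v2 ++ q].
Proof.
move=> hs ht /negPn /infixP [p [q e]].
have [ps|sp] := leqP (size p) (size s); last first.
  have [r pr tr] := cat_split e (ltnW sp).
  by move: ht; rewrite tr => /vfree_catr /vfree_catl;
    rewrite /avoids infix_refl.
have [v1 sE vq] := cat_split (esym e) ps.
have [vv|vv] := leqP (size v) (size v1).
  have [r v1E _] := cat_split vq vv.
  by move: hs; rewrite sE v1E => /vfree_catr /vfree_catl;
    rewrite /avoids infix_refl.
have [v2 vE tE] := cat_split (esym vq) (ltnW vv).
by exists p, v1, v2, q.
Qed.

End Avoiding.

Section NonOverlapping.
Variables u v : seq letter.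
Hypothesis huv : standing_assumptions u v.
Hypothesis hlcm : right_LCM (P u v).
Hypothesis hrev : left_reversible (P u v).
Local Notation M := (P u v).
Local Notation cl := (eltP u v).
Local Notation chiw := (chi_inf (onerel u v)).

Hypothesis no_overlap : [/\ ~~ infix u v,
       (forall p, p <> [::] -> prefix p u -> ~~ suffix p v),
       (forall s, s <> [::] -> suffix s u -> ~~ prefix s v)
     & ~~ infix v u].
Local Notation vfree := (avoids v).

Lemma vfree_u_cat t : vfree t -> vfree (u ++ t).
Proof.
have [_ _ suf vu] := no_overlap => ht; apply: contrapT => /negP.
move=> /(straddle vu ht) [p [v1 [v2 [q [uE vE tE]]]]].
have [v10|v1n] := pselect (v1 = [::]).
  by move: ht; rewrite tE vE v10 /= => /vfree_catl; rewrite /avoids infix_refl.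
have v1u : suffix v1 u by rewrite uE suffix_suffix.
by move/negP: (suf v1 v1n v1u); apply; rewrite vE prefix_prefix.
Qed.

(** An occurrence of [v] can neither contain, nor be contained in, nor overlap
    an occurrence of [u]. *)
Lemma vfree_cat_u s t : vfree s -> vfree t -> vfree (s ++ u ++ t).
Proof.
have [uv pre _ _] := no_overlap => hs ht; apply: contrapT => /negP.
move=> /(straddle hs (vfree_u_cat ht)) [p [v1 [v2 [q [sE vE tE]]]]].
have [v2u|uv2] := leqP (size v2) (size u).
  have [r uE _] := cat_split (esym tE) v2u.
  have [v20|v2n] := pselect (v2 = [::]).
    by move: hs; rewrite sE vE v20 cats0 => /vfree_catr;
      rewrite /avoids infix_refl.
  have v2u' : prefix v2 u by rewrite uE prefix_prefix.
  by move/negP: (pre v2 v2n v2u'); apply; rewrite vE suffix_suffix.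
have [r v2E _] := cat_split tE (ltnW uv2).
by move/negP: uv; apply; apply/infixP; exists v1, r; rewrite vE v2E.
Qed.

Lemma vfree_u : vfree u.
Proof. by have [] := no_overlap. Qed.

Lemma vfree_nil : vfree [::].
Proof. exact: (@vfree_sub v [::] [::] u) vfree_u. Qed.

(** Appending a letter to a word avoiding [v] creates at most one occurrence of
    [v], at the end; replacing it by [u] creates no other. *)
Lemma vfree_rep (r : M) : exists2 s, vfree s & r = cl s.
Proof.
have [s ->] := wcl_surj r; elim/last_ind: s => [|s c [t tfree st]].
  by exists [::] => //; exact: vfree_nil.
rewrite -cats1 wclM st -wclM.
have [|/negP h] := pselect (vfree (t ++ [:: c])); first by exists (t ++ [:: c]).
have [/infixP [p [q e]]] := negPn h.
case/lastP: q e => [|q d]; last first.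
  rewrite cats1 -!rcons_cat => /rcons_inj [tE _].
  by move: tfree; rewrite tE => /vfree_sub; rewrite /avoids infix_refl.
rewrite cats0 => e; exists (p ++ u); last by rewrite e !wclM eltP_uv.
have := @vfree_cat_u p [::]; rewrite cats0; apply; last exact: vfree_nil.
have v0 : v <> [::] by have [[]] := huv.
have [v' [d vE]] : exists v' d, v = rcons v' d.
  by case/lastP: v v0 => // v' d _; exists v', d.
have : t ++ [:: c] = p ++ rcons v' d by rewrite e -vE.
rewrite cats1 -rcons_cat => /rcons_inj [tE _].
by move: tfree; rewrite tE; exact: vfree_catl.
Qed.

Variable w : M.
Hypothesis w_two_sided : forall p x : M, rideal w x -> rideal w (p * x).
Variable k : nat.
Hypothesis hk : forall r s : seq letter,
      ~~ infix v (la :: r) -> ~~ infix v (lb :: s) ->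
      (k <= size r)%N -> (k <= size s)%N ->
      rideal (cl (la :: r)) `&` rideal (cl (lb :: s)) `<=` rideal w.

(** After cancellation of the common prefix the two words begin with different
    letters, and then a common multiple outside [w P] leaves at most [k] further
    letters to one of them. *)
Lemma vfree_agree e e' (r : M) n : vfree e -> vfree e' ->
  rideal (cl e) r -> rideal (cl e') r -> ~ rideal w r ->
  (n + k < size e)%N -> (n + k < size e')%N -> take n e = take n e'.
Proof.
elim: n e e' r => [|n ih] e e' r he he' er er' rw; first by rewrite !take0.
case: e he er => [|c e] he er //; case: e' he' er' => [|d e']
  he' er' //= le le'.
have cd : c = d.
  case: c d he er he' er' => -[] // he er he' er'; exfalso; apply: rw.
    apply: (hk he he') => //; lia.
  apply: (hk he' he) => //; lia.
subst d; congr cons.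
have [t _ tr] := er; rewrite -cat1s wclM -mulgA in tr.
rewrite -tr in er er' rw.
apply: (ih _ _ (cl e * t)) => //.
- by move: he; rewrite -cat1s; exact: vfree_catr.
- by move: he'; rewrite -cat1s; exact: vfree_catr.
- exact: ridealMr.
- by move: er'; rewrite -cat1s wclM => /(rideal_mull huv).
- by move=> h; apply: rw; exact: w_two_sided.
Qed.

Variable W : seq (seq letter).
Hypothesis W_sub : forall z, z \in W -> ~~ infix v z /\ rideal w (cl z).
Hypothesis W_all : forall z, ~~ infix v z -> rideal w (cl z) ->
      exists2 x0, x0 \in W & infix x0 z.
Local Notation F := (v :: W).

(** Containing a member of [W] puts a word in [w P], as this ideal is two-sided;
    and [W] was chosen so that a word avoiding [v]
      gets there in no other way. *)
Lemma free_infW z : free_inf F z <->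
  forall n, vfree (mkseq z n) /\ ~ rideal w (cl (mkseq z n)).
Proof.
rewrite free_infP; split=> h n.
  have /andP[vz /allP Wz] := h n; split=> // /(W_all vz) [x xW].
  exact/negP/Wz.
have [vz wz] := h n; apply/andP; split=> //; apply/allP => x xW.
apply/negP => /infixP [p [q zE]]; apply: wz; rewrite zE !wclM.
by apply: w_two_sided; apply: rideal_mulr; have [] := W_sub xW.
Qed.

Lemma F_vfree z n : free_inf F z -> vfree (mkseq z n).
Proof. by move=> /free_infW /(_ n) []. Qed.

Lemma F_outside z n : free_inf F z -> ~ rideal w (cl (mkseq z n)).
Proof. by move=> /free_infW /(_ n) []. Qed.

Lemma avoiding_rigid : exists k, forall z z' n, free_inf F z -> free_inf F z' ->
  ev (chiw z') (Jid (cl (mkseq z (n + k)))) -> mkseq z' n = mkseq z n.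
Proof.
exists k.+1 => z z' n fz fz' /ev_chi_inf [m zm].
pose m' := (n + k.+1 + m)%N.
have h : rideal (cl (mkseq z (n + k.+1))) (cl (mkseq z' m')).
  by apply: rideal_mkseq zm; exact: leq_addl.
have := @vfree_agree _ _ (cl (mkseq z' m')) n (F_vfree (n + k.+1) fz) (F_vfree
  m' fz')
  h (rideal_refl _) (F_outside (n := m') fz').
rewrite !size_mkseq => /(_ _ _)/esym.
have nE i : (n <= i)%N -> forall y : nat -> letter,
  take n (mkseq y i) = mkseq y n.
  by move=> /subnKC <- y; rewrite mkseqD take_size_cat ?size_mkseq.
by rewrite !nE; [apply|..]; rewrite /m'; lia.
Qed.

(** An infinite word [s z] contains [v] at most across the border, and replacing
    one such occurrence by [u] removes all of them. *)
Lemma avoiding_replace (x : M) : exists N, forall z, free_inf F z ->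
  (forall n, ~ rideal w (x * cl (mkseq z n))) ->
  exists h i, [/\ (size h <= N)%N, cl h = x * cl (mkseq z i)
                & free_inf F (wcat h (wshift i z))].
Proof.
have [s sfree ->] := vfree_rep x; exists (size s + size u)%N => z fz hw.
suff [h [i [hN hE hfree]]] : exists h i, [/\ (size h <= size s + size u)%N,
    cl h = cl s * cl (mkseq z i) & forall n, vfree (h ++ mkseq (wshift i z) n)].
  exists h, i; split=> //; apply/free_infW => n.
  have e := mkseq_wcat h (wshift i z) n; split.
    by apply: (vfree_mkseq_le (leq_addl (size h) n)); rewrite e.
  move=> /(rideal_mkseq (leq_addl (size h) n));
    rewrite e wclM hE -mulgA -(wclM _ (mkseq z i)).
  by rewrite -mkseqD; exact: hw.
have [h|] := pselect (forall n, vfree (s ++ mkseq z n)).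
  exists s, 0%N; split=> //; first exact: leq_addr.
  by rewrite -[RHS]wclM cats0.
move=> /existsNP [n /negP /(straddle sfree (F_vfree n fz))].
move=> [p [v1 [v2 [q [sE vE zE]]]]].
have v2E : mkseq z (size v2) = v2.
  have nE : n = (size v2 + size q)%N.
    by rewrite -(size_mkseq z n) zE size_cat.
  move: zE; rewrite nE mkseqD => /eqP; rewrite eqseq_cat ?size_mkseq //.
  by case/andP => /eqP.
exists (p ++ u), (size v2); split.
- by rewrite sE !size_cat leq_add2r leq_addr.
- by rewrite v2E sE -(wclM _ (p ++ v1)) -catA -vE !wclM eltP_uv.
move=> m; rewrite -catA; apply: vfree_cat_u.
  by move: sfree; rewrite sE; exact: vfree_catl.
by apply: F_vfree; exact: free_inf_shift.
Qed.

Lemma avoiding_of_chain chi (Q : set (seq letter)) c0 : Yset w chi -> Q c0 ->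
  (forall c, Q c -> vfree c /\ ev chi (Jid (cl c))) ->
  (forall c p, Q c -> ev chi (Jid p) ->
     exists e, Q (c ++ e) /\ rideal p (cl (c ++ e))) ->
  exists2 z, free_inf F z & chi = chiw z.
Proof.
move=> [chiinf chiw0] Q0 Qv Qext.
have [|z [chiE zQ]] := chi_inf_of_chain hlcm hrev chiinf Q0 _ Qext.
  by move=> c /Qv [].
exists z => //; apply/free_infW => n; split.
  have [c /Qv [cv _]] := zQ n.
  by move=> /prefixP [q cE]; move: cv; rewrite cE; exact: vfree_catl.
move=> hn; move/negP: chiw0; apply; rewrite chiE; apply/ev_chi_inf.
by exists n.
Qed.

(** A word of this form can be followed by any word avoiding [v]
  without creating
    an occurrence of [v]. *)
Definition locked c := c = [::] \/ exists2 d, vfree d & c = d ++ u.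

Lemma vfree_locked c t : locked c -> vfree t -> vfree (c ++ t).
Proof.
by move=> [->//|[d dv ->]] tv; rewrite -catA; exact: vfree_cat_u.
Qed.

Lemma locked_cat c d : locked c -> vfree d -> locked (c ++ d ++ u).
Proof.
move=> hc dv; right; exists (c ++ d); last by rewrite catA.
exact: vfree_locked.
Qed.

(** Either locked words are cofinal in the filter above any locked word in it,
    and they form the required chain; or beyond some locked [c] and some element
    [p] of the filter no locked extension remains in it. In the latter case, a
    product [d t] of words avoiding [v] with [c d t]
      in the filter never contains
    [v], since otherwise rewriting it would produce a locked extension, and so
    words can be prolonged freely. *)
Lemma avoiding_Yset chi : Yset w chi -> exists2 z, free_inf F z & chi = chiw z.
Proof.
move=> Ychi; pose Q0 := [set c | locked c /\ ev chi (Jid (cl c))].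
have [ext|] := pselect (forall c p, Q0 c -> ev chi (Jid p) ->
    exists e, Q0 (c ++ e) /\ rideal p (cl (c ++ e))).
  apply: (avoiding_of_chain (c0 := [::]) Ychi _ _ ext).
    by split; [left|exact: ev_one].
  move=> c [hc cchi]; split=> //.
  by have := vfree_locked hc vfree_nil; rewrite cats0.
move=> /existsNP [c /existsNP [p /not_implyP [[hc cchi]
  /not_implyP [pchi stuck]]]].
have [r [_ [q _ cq] pr rchi]] := ev_lcm hlcm hrev cchi pchi.
have [s sv sE] := vfree_rep q; rewrite {}sE -wclM in cq.
pose Q1 := [set b | exists d, [/\ b = c ++ d, vfree d,
  prefix s d & ev chi (Jid (cl b))]].
apply: (avoiding_of_chain (Q := Q1) (c0 := c ++ s) Ychi).
- by exists s; rewrite prefix_refl cq.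
- by move=> _ [d [-> dv _ dchi]]; split=> //; exact: vfree_locked.
move=> _ p' [d [-> dv sd dchi]] p'chi.
have [r' [_ [q' _ cdq] p'r r'chi]] := ev_lcm hlcm hrev dchi p'chi.
have [t tv tE] := vfree_rep q'; rewrite {}tE -wclM in cdq.
exists t; rewrite cdq; split=> //; exists (d ++ t); rewrite catA; split=> //.
- apply: contrapT => /negP /(straddle dv tv) [d' [v1 [v2 [t' [dE vE tE]]]]].
  have cE : cl (c ++ d' ++ u) = cl (c ++ d) * cl v2.
    by rewrite -wclM dE -!catA -vE !(wclM _ c) !(wclM _ d') eltP_uv.
  apply: stuck; exists (d' ++ u); split; first split.
  + apply: locked_cat => //; by move: dv; rewrite dE; exact: vfree_catl.
  + apply: (ev_mono _ r'chi); rewrite cE -cdq wclM tE (wclM _ v2) mulgA.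
    exact: ridealMr.
  + rewrite cE; apply: rideal_mulr; apply: rideal_trans pr _.
    have /prefixP [d2 ->] := sd; rewrite -cq catA (wclM _ (c ++ s));
      exact: ridealMr.
- by have /prefixP [d2 ->] := sd; rewrite -catA prefix_prefix.
- by rewrite -catA in cdq *; rewrite cdq.
Qed.

Lemma avoiding_graph_model (L : nat) : (0 < L)%N ->
  (forall x, x \in F -> (size x <= L.+1)%N) ->
  @graph_model u v (block_graph F L) (@block_label F L) (Yset w).
Proof.
move=> L0 LF; apply: graph_model_criterion => //.
- by move=> z n; exact: F_outside.
- exact: avoiding_rigid.
- exact: avoiding_replace.
- exact: avoiding_Yset.
Qed.

End NonOverlapping.

(** * Lengths of the forbidden words *)

Section Lengths.
Variables u v : seq letter.
Hypothesis huv : standing_assumptions u v.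

Lemma letter_neq_power (c : letter) n : eltP u v [:: c]
  <> eltP u v (nseq n (~~ c)).
Proof. by have [_ _ [ab ba] _ _] := huv; case: c; [exact: ab|exact: ba]. Qed.

(** The blocks must be non-empty for their first letter to be a label. *)
Lemma size_relators : (1 < maxn (size u) (size v))%N.
Proof.
have [[u0 v0] uv _ _ _] := huv; have := @letter_neq_power.
case: u v u0 v0 uv => [//|c [|c' s]] [|d t] // _ _ cd; last by rewrite leq_max.
case: t cd => [|d' t] cd; last by rewrite leq_max orbT.
have -> : d = ~~ c by case: c d cd => -[].
move=> h; case: (h c 1%N).
exact: (@eltP_uv [:: c] [:: ~~ c]).
Qed.

Lemma size_v_gt1 : ~~ infix v u -> (1 < size v)%N.
Proof.
have [[_ v0] _ _ _ _] := huv; have := @letter_neq_power.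
case: v v0 => [//|c [|//]] _ h cu; exfalso.
have uE : u = nseq (size u) (~~ c).
  apply/all_pred1P/allP => d du /=; apply: contraNT cu => dc.
  have {dc} cd : c = d by case: c d dc {du h} => -[].
  by rewrite cd; apply/infixP; move: du => /path.splitPr [p q]; exists p, q.
by apply: (h c (size u)); rewrite -uE eltP_uv.
Qed.

End Lengths.

(** * Graph models for the action on [Y] *)

Theorem theorem4p3 (u v : seq letter)
    (huv : standing_assumptions u v)
    (hlcm : right_LCM (P u v)) (hrev : left_reversible (P u v))
    (w x x' y y' : P u v)
    (hwa : w = eltP u v [:: la] * x) (hwx : w = x * x')
    (hwb : w = eltP u v [:: lb] * y) (hwy : w = y * y') :
  (w = eltP u v u ->
   let L := (maxn (size u) (size v)).-1 in
   @graph_model u v (block_graph [:: u; v] L) (@block_label [:: u; v] L)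
     (Yset w))
  /\
  (forall W : seq (seq letter),
   (forall z, z \in W ->
      ~~ infix v z /\ rideal w (eltP u v z)) ->
   (forall z, ~~ infix v z -> rideal w (eltP u v z) ->
      exists2 x0, x0 \in W & infix x0 z) ->
   [/\ ~~ infix u v,
       (forall p, p <> [::] -> prefix p u -> ~~ suffix p v),
       (forall s, s <> [::] -> suffix s u -> ~~ prefix s v)
     & ~~ infix v u] ->
   (exists k : nat, forall r s : seq letter,
      ~~ infix v (la :: r) -> ~~ infix v (lb :: s) ->
      (k <= size r)%N -> (k <= size s)%N ->
      rideal (eltP u v (la :: r)) `&`
        rideal (eltP u v (lb :: s)) `<=` rideal w) ->
   let L := (\max_(z <- v :: W) size z).-1 in
   @graph_model u v (block_graph (v :: W) L) (@block_label (v :: W) L)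
     (Yset w)).
Proof.
have w_two_sided := rideal_two_sided hwa hwx hwb hwy.
split=> [wu|W W_sub W_all no_overlap [k hk]] L.
  have L1 := size_relators huv.
  have LE : L.+1 = maxn (size u) (size v) by rewrite prednK // ltnW.
  apply: relator_graph_model => //; first by rewrite -ltnS LE.
  by move=> z; rewrite LE !inE => /orP [] /eqP ->; rewrite leq_max leqnn ?orbT.
have [_ _ _ vu] := no_overlap.
have vmax z : z \in v :: W -> (size z <= \max_(z <- v :: W) size z)%N.
  move=> zW.
  exact: (@leq_bigmax_seq _ (v :: W) xpredT (fun z => size z)) zW _.
have L1 : (1 < \max_(z <- v :: W) size z)%N.
  exact: leq_trans (size_v_gt1 huv vu) (vmax _ (mem_head _ _)).
have LE : L.+1 = \max_(z <- v :: W) size z by rewrite prednK // ltnW.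
apply: (avoiding_graph_model huv hlcm hrev no_overlap w_two_sided
          hk W_sub W_all).
  by rewrite -ltnS LE.
by move=> z; rewrite LE; exact: vmax.
Qed.
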